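(* Let $n\ge2$, $b>0$, $\gamma\in\mathbb{R}$, $s\ge0$, and suppose that $f\in H^s(\Omega;\mathbb{R}^n)$, $g\in H^{s+1}(\Omega)$, $h\in H^{s+3/2}(\Sigma_b)$, and $k\in H^{s+1/2}(\Sigma_b;\mathbb{R}^n)$. Assume that the problem $$\begin{cases}\operatorname{div}S(p,u)-\gamma\partial_1u=f&\text{in }\Omega\\ \operatorname{div}u=g&\text{in }\Omega\\ S(p,u)e_n=k,\quad u_n=h&\text{on }\Sigma_b\\ u=0&\text{on }\Sigma_0\end{cases}$$ admits a solution $u\in{}_0H^{s+2}(\Omega;\mathbb{R}^n)$ and $p\in H^{s+1}(\Omega)$. For every $\psi\in H^{s+1/2}(\Sigma_b)$ let $v\in{}_0H^{s+2}(\Omega;\mathbb{R}^n)$ and $q\in H^{s+1}(\Omega)$ be the unique solution to the adjoint problem $$\begin{cases}\operatorname{div}S(q,v)+\gamma\partial_1v=0&\text{in }\Omega\\ \operatorname{div}v=0&\text{in }\Omega\\ S(q,v)e_n=\psi e_n&\text{on }\Sigma_b\\ v=0&\text{on }\Sigma_0.\end{cases}$$ Then $$\int_\Omega(f\cdot v-gq)-\int_{\Sigma_b}(k\cdot v-h\psi)=0.$$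
   Context: $\Omega=\mathbb{R}^{n-1}\times(0,b)$, $\Sigma_b=\{x_n=b\}$ (identified with $\mathbb{R}^{n-1}$), $\Sigma_0=\{x_n=0\}$. $H^s$ are the usual $L^2$-based real Sobolev spaces, ${}_0H^s(\Omega;\mathbb{R}^n)=\{u\in H^s(\Omega;\mathbb{R}^n):u=0\text{ on }\Sigma_0\}$. $\mathbb{D}u=\nabla u+(\nabla u)^\intercal$, $S(p,u)=pI-\mathbb{D}u$, and $\operatorname{div}S(p,u)=\nabla p-\Delta u-\nabla\operatorname{div}u$. The adjoint problem has a unique solution in the stated class for every $\psi\in H^{s+1/2}(\Sigma_b)$, because $(v,q)\mapsto(\operatorname{div}S(q,v)+\gamma\partial_1v,\operatorname{div}v,S(q,v)e_n|_{\Sigma_b})$ is an isomorphism ${}_0H^{s+2}(\Omega;\mathbb{R}^n)\times H^{s+1}(\Omega)\to H^s(\Omega;\mathbb{R}^n)\times H^{s+1}(\Omega)\times H^{s+1/2}(\Sigma_b;\mathbb{R}^n)$. *)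

(* Defs.v *)
From HB Require Import structures.
From mathcomp Require Import all_boot all_order all_algebra.
From mathcomp Require Import all_classical all_reals all_analysis.

Set Implicit Arguments.
Unset Strict Implicit.
Unset Printing Implicit Defensive.
Import Order.TTheory GRing.Theory Num.Theory.
Import numFieldNormedType.Exports.

Local Open Scope classical_set_scope.
Local Open Scope ring_scope.

Definition rV_display : measure_display -> measure_display.
Proof. exact. Qed.

Section measurable_rV.
Context {R : realType} {n : nat}.

Definition rV_coord (i : 'I_n) (x : 'rV[R]_n) : measurableTypeR R := x 0 i.

(* the Borel sigma-algebra of R^n, generated by the coordinate functions *)
Let rV_set0 : g_sigma_preimage rV_coord set0.
Proof. exact: sigma_algebra0. Qed.

Let rV_setC A : g_sigma_preimage rV_coord A -> g_sigma_preimage rV_coord (~` A).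
Proof. exact: sigma_algebraC. Qed.

Let rV_bigcup (F : (set 'rV[R]_n)^nat) :
  (forall i, g_sigma_preimage rV_coord (F i)) ->
  g_sigma_preimage rV_coord (\bigcup_i (F i)).
Proof. exact: sigma_algebra_bigcup. Qed.

HB.instance Definition _ := @isMeasurable.Build
  (rV_display default_measure_display) 'rV[R]_n (g_sigma_preimage rV_coord) rV_set0 rV_setC rV_bigcup.

Lemma measurable_rV_coord (i : 'I_n) :
  measurable_fun [set: 'rV[R]_n] (rV_coord i).
Proof.
move=> _ Y mY; rewrite setTI; apply: sub_sigma_algebra => /=.
rewrite -bigcup_seq/=; exists i => /=; first by rewrite mem_index_enum.
by exists Y => //; rewrite setTI.
Qed.

Lemma measurable_fun_rVP d (T : measurableType d) (f : T -> 'rV[R]_n) :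
  (forall i, measurable_fun setT (rV_coord i \o f)) -> measurable_fun setT f.
Proof.
move=> mf; suff h : g_sigma_preimage (fun i => rV_coord i \o f) `<=` measurable.
  move=> _ A mA; apply: h; rewrite g_sigma_preimage_comp; by exists A.
apply: smallest_sub; first exact: sigma_algebra_measurable.
rewrite -bigcup_seq; apply: bigcup_sub => i _ A [B mB <-]; exact: mf.
Qed.

End measurable_rV.

Section rV_cons.
Context {R : realType} {n : nat}.

Definition rV_cons (z : measurableTypeR R * 'rV[R]_n) : 'rV[R]_n.+1 :=
  \row_j (if unlift ord0 j is Some k then z.2 0 k else z.1).

Definition rV_uncons (x : 'rV[R]_n.+1) : measurableTypeR R * 'rV[R]_n :=
  (rV_coord ord0 x, \row_j x 0 (lift ord0 j)).

Lemma rV_consE0 z : rV_coord ord0 (rV_cons z) = z.1.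
Proof. by rewrite /rV_coord mxE unlift_none. Qed.

Lemma rV_consES z j : rV_coord (lift ord0 j) (rV_cons z) = rV_coord j z.2.
Proof. by rewrite /rV_coord mxE liftK. Qed.

Lemma rV_consK : cancel rV_cons rV_uncons.
Proof.
move=> z; rewrite /rV_uncons rV_consE0 [RHS]surjective_pairing; congr pair.
by apply/rowP => j; rewrite mxE; exact: rV_consES.
Qed.

Lemma measurable_rV_cons : measurable_fun setT rV_cons.
Proof.
apply: measurable_fun_rVP => i; case: (unliftP ord0 i) => [j|] ->.
  rewrite (_ : _ \o _ = rV_coord j \o snd); last first.
    by apply/funext => z; exact: rV_consES.
  by apply: measurableT_comp => //; exact: measurable_rV_coord.
rewrite (_ : _ \o _ = fst); last by apply/funext => z; exact: rV_consE0.
exact: measurable_fst.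
Qed.

Lemma measurable_rV_uncons : measurable_fun setT rV_uncons.
Proof.
apply/measurable_fun_pairP; split; first exact: measurable_rV_coord.
apply: measurable_fun_rVP => j.
rewrite (_ : _ \o _ = rV_coord (lift ord0 j)); first exact: measurable_rV_coord.
by apply/funext => x; rewrite /= /rV_coord mxE.
Qed.

End rV_cons.

Section lebesgue_cons.
Local Open Scope ereal_scope.
Context {R : realType} {n : nat}.
Variable mu : {sigma_finite_measure set 'rV[R]_n -> \bar R}.

Definition lebesgue_cons : set 'rV[R]_n.+1 -> \bar R :=
  pushforward (@lebesgue_measure R \x mu) rV_cons.

Let lebesgue_cons0 : lebesgue_cons set0 = 0.
Proof. by rewrite /lebesgue_cons /pushforward preimage_set0 measure0. Qed.

Let lebesgue_cons_ge0 A : 0 <= lebesgue_cons A.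
Proof. by rewrite /lebesgue_cons /pushforward; exact: measure_ge0. Qed.

Let lebesgue_cons_sigma_additive : semi_sigma_additive lebesgue_cons.
Proof.
move=> F mF tF mUF; rewrite /lebesgue_cons /pushforward preimage_bigcup.
apply: measure_semi_sigma_additive.
- by move=> k; rewrite -[X in measurable X]setTI; exact: measurable_rV_cons.
- apply/trivIsetP => /= i j _ _ ij; rewrite -preimage_setI.
  by move/trivIsetP : tF => /(_ _ _ _ _ ij) ->//; rewrite preimage_set0.
- by rewrite -preimage_bigcup -[X in measurable X]setTI; exact: measurable_rV_cons.
Qed.

HB.instance Definition _ := isMeasure.Build _ _ _ lebesgue_cons
  lebesgue_cons0 lebesgue_cons_ge0 lebesgue_cons_sigma_additive.

Let lebesgue_cons_sigma_finite : sigma_finite setT lebesgue_cons.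
Proof.
have /sigma_finiteP[F [TF ndF Foo]] := sigma_finiteT (@lebesgue_measure R).
have /sigma_finiteP[G [TG ndG Goo]] := sigma_finiteT mu.
exists (fun k => rV_uncons @^-1` (F k `*` G k)).
  apply/esym; rewrite -subTset => x _.
  have [i _ Fi] : (\bigcup_i F i) (rV_uncons x).1 by rewrite -TF.
  have [j _ Gj] : (\bigcup_i G i) (rV_uncons x).2 by rewrite -TG.
  exists (maxn i j) => //; split.
    by move: Fi; exact/subsetPset/ndF/leq_maxl.
  by move: Gj; exact/subsetPset/ndG/leq_maxr.
move=> k; have [mF Fk] := Foo k; have [mG Gk] := Goo k; split.
  rewrite -[X in measurable X]setTI; apply: measurable_rV_uncons => //.
  exact: measurableX.
rewrite /lebesgue_cons /pushforward -comp_preimage.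
rewrite (_ : _ \o _ = idfun); last by apply/funext => z; exact: rV_consK.
by rewrite preimage_id product_measure1E// lte_mul_pinfty// ge0_fin_numE.
Qed.

HB.instance Definition _ := Measure_isSigmaFinite.Build _ _ _ lebesgue_cons
  lebesgue_cons_sigma_finite.

End lebesgue_cons.

Fixpoint lebesgue {R : realType} (n : nat) :
    {sigma_finite_measure set 'rV[R]_n -> \bar R} :=
  match n return {sigma_finite_measure set 'rV[R]_n -> \bar R} with
  | 0 => dirac (0 : 'rV[R]_0)
  | k.+1 => lebesgue_cons (lebesgue k)
  end.
Arguments lebesgue {R n}.

Section sobolev.
Context {R : realType} {n : nat}.
Implicit Types (D : set 'rV[R]_n) (f g w phi : 'rV[R]_n -> R).

Definition pderiv (i : 'I_n) phi : 'rV[R]_n -> R :=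
  fun x => 'D_(delta_mx 0 i) phi x.

Definition smooth phi : Prop := forall l : seq 'I_n,
  continuous (foldr pderiv phi l) /\
  forall i x, derivable (foldr pderiv phi l) x (delta_mx 0 i).

Definition test_fun D phi : Prop :=
  smooth phi /\
  exists K, [/\ compact K, K `<=` D & forall x, ~ K x -> phi x = 0].

Definition L2norm2 D f : \bar R := (\int[lebesgue]_(x in D) (f x ^+ 2)%:E)%E.

Definition L2 D f : Prop := measurable_fun D f /\ (L2norm2 D f < +oo)%E.

Definition is_wpderiv D (i : 'I_n) f w : Prop :=
  [/\ L2 D f, L2 D w & forall phi, test_fun D phi ->
    \int[lebesgue]_(x in D) (f x * pderiv i phi x) =
    - \int[lebesgue]_(x in D) (w x * phi x)].

(* a representative of the weak derivative, which is unique up to null sets;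
   the junk value 0 is returned when there is no weak derivative in L^2 *)
Definition wpderiv D (i : 'I_n) f : 'rV[R]_n -> R :=
  xget (fun=> 0) (is_wpderiv D i f).

Definition enorm (x : 'rV[R]_n) : R := Num.sqrt (\sum_i x 0 i ^+ 2).

(* square of the Gagliardo seminorm of order t, for 0 < t < 1 *)
Definition gagliardo (t : R) D f : \bar R :=
  (\int[lebesgue \x lebesgue]_(z in D `*` D)
     ((f z.1 - f z.2) ^+ 2 / enorm (z.1 - z.2) `^ (n%:R + 2 * t))%:E)%E.

(* H^(k+t)(D) for 0 <= t < 1: the derivatives of order at most k are obtained by
   iterating first-order ones; the Gagliardo condition is on those of order k *)
Fixpoint sobolev_rec (t : R) (k : nat) D f : Prop :=
  match k with
  | 0 => L2 D f /\ (0 < t -> (gagliardo t D f < +oo)%E)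
  | k'.+1 => L2 D f /\
      forall i, exists2 w, is_wpderiv D i f w & sobolev_rec t k' D w
  end.

(* only meaningful for r >= 0 *)
Definition sobolev (r : R) D f : Prop :=
  sobolev_rec (r - (Num.truncn r)%:R) (Num.truncn r) D f.

(* square of the H^1(D) distance from a smooth [phi] to [f] *)
Definition H1dist2 D phi f : \bar R :=
  (L2norm2 D (phi \- f)%R +
   \sum_(i < n) L2norm2 D (pderiv i phi \- wpderiv D i f)%R)%E.

End sobolev.

(* n = m.+1: x_1 has index ord0 and x_n index ord_max; [u i] is the component
   of index i of the vector field u *)
Section slab.
Context {R : realType} {m : nat}.
Implicit Types (f g phi p : 'rV[R]_m.+1 -> R) (b c : R).
Implicit Types (u : 'I_m.+1 -> 'rV[R]_m.+1 -> R) (i j : 'I_m.+1).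

Definition slab b : set 'rV[R]_m.+1 := [set x | 0 < x 0 ord_max < b].

(* the point (y, c) of the hyperplane x_n = c *)
Definition at_height c (y : 'rV[R]_m) : 'rV[R]_m.+1 :=
  \row_j (if unlift ord_max j is Some k then y 0 k else c).

(* [w] is the trace on x_n = c of [f] in H^1 of the slab: the graph of the
   trace operator is the closure in H^1 x L^2 of the graph of the restriction
   operator on functions that are smooth and compactly supported in R^n *)
Definition has_trace b c f (w : 'rV[R]_m -> R) : Prop :=
  [/\ sobolev 1 (slab b) f, L2 setT w &
    exists phi : nat -> 'rV[R]_m.+1 -> R,
    [/\ forall k, test_fun setT (phi k),
        (fun k => H1dist2 (slab b) (phi k) f) @ \oo --> 0%E &
        (fun k => L2norm2 setT ((phi k \o at_height c) \- w)) @ \oo --> 0%E]].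

Definition trace b c f : 'rV[R]_m -> R := xget (fun=> 0) (has_trace b c f).

Definition sobolev0 (r : R) b u : Prop :=
  forall i, sobolev r (slab b) (u i) /\ has_trace b 0 (u i) (fun=> 0).

Definition wdiv b u : 'rV[R]_m.+1 -> R :=
  fun x => \sum_j wpderiv (slab b) j (u j) x.

Definition symgrad b u i j : 'rV[R]_m.+1 -> R :=
  fun x => wpderiv (slab b) j (u i) x + wpderiv (slab b) i (u j) x.

Definition stress b p u i j : 'rV[R]_m.+1 -> R :=
  fun x => p x *+ (i == j) - symgrad b u i j x.

Definition div_stress b p u i : 'rV[R]_m.+1 -> R := wdiv b (stress b p u i).

Definition ae_slab b (f g : 'rV[R]_m.+1 -> R) : Prop :=
  {ae (@lebesgue R m.+1), forall x, slab b x -> f x = g x}.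

Definition solves_overdetermined (gamma s b : R)
    (f : 'I_m.+1 -> 'rV[R]_m.+1 -> R) (g : 'rV[R]_m.+1 -> R)
    (h : 'rV[R]_m -> R) (k : 'I_m.+1 -> 'rV[R]_m -> R) u p : Prop :=
  [/\ sobolev0 (s + 2) b u /\ sobolev (s + 1) (slab b) p,
      forall i, ae_slab b
        (fun x => div_stress b p u i x - gamma * wpderiv (slab b) ord0 (u i) x)
        (f i),
      ae_slab b (wdiv b u) g,
      forall i, has_trace b b (stress b p u i ord_max) (k i) &
      has_trace b b (u ord_max) h].

Definition solves_adjoint (gamma s b : R) (psi : 'rV[R]_m -> R)
    (v : 'I_m.+1 -> 'rV[R]_m.+1 -> R) (q : 'rV[R]_m.+1 -> R) : Prop :=
  [/\ sobolev0 (s + 2) b v /\ sobolev (s + 1) (slab b) q,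
      forall i, ae_slab b
        (fun x => div_stress b q v i x + gamma * wpderiv (slab b) ord0 (v i) x)
        (fun=> 0),
      ae_slab b (wdiv b v) (fun=> 0) &
      forall i, has_trace b b (stress b q v i ord_max)
        (fun y => psi y *+ (i == ord_max))].

End slab.

(* Main.v *)
(* Green's formula, twice.  Testing the equation for (u, p) with v and the
   equation for (v, q) with u produces the same symmetric form
   (1/2) \int Du : Dv, and subtracting the two leaves the boundary terms.

   The integrations by parts are made for weak derivatives.  In the direction
   x_n every component in play has a trace, hence comes with a sequence of
   smooth compactly supported functions converging to it in H^1 of the slab; one
   applies Fubini and the fundamental theorem of calculus to products of such
   functions and passes to the limit.  The inequality
     b \int_{x_n = b} phi^2 <= (1 + b) \int phi^2 + b \int (d_n phi)^2
   makes the restrictions of any such sequence to both faces converge, so a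
   function with a trace on one face has one on the other.  In a tangential
   direction a component of the stress need not be approximable by smooth
   functions, but only one factor has to be: a smooth phi times a cutoff in x_n
   is a test function of the slab, and the cutoff does not see tangential
   derivatives. *)
Require Import Defs.
From mathcomp Require Import all_boot all_order all_algebra.
From mathcomp Require Import all_classical all_reals all_analysis.
From mathcomp Require Import measurable_realfun ring lra.
Import Order.TTheory GRing.Theory Num.Theory.
Import numFieldNormedType.Exports.
Local Open Scope classical_set_scope.
Local Open Scope ring_scope.
Set Implicit Arguments.
Unset Strict Implicit.
Unset Printing Implicit Defensive.

(** * Square-integrable functions *)

Section L2_space.
Context {R : realType} {n : nat}.
Variable D : set 'rV[R]_n.
Hypothesis mD : measurable D.
Implicit Types f g h : 'rV[R]_n -> R.

(** The real-valued integral is meaningful only when the product is integrable, so the linearity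
    rules below carry [L2] hypotheses. Symmetry needs none. *)
Definition ip f g : R := \int[lebesgue]_(x in D) (f x * g x).

Lemma L2_integrable_sqr f : L2 D f ->
  lebesgue.-integrable D (EFin \o (fun x => f x ^+ 2)).
Proof.
move=> [mf foo]; apply/integrableP; split.
  by apply/measurable_EFinP; exact: measurable_funX.
apply: le_lt_trans foo; rewrite le_eqVlt; apply/orP; left; apply/eqP.
by apply: eq_integral => x _ /=; rewrite ger0_norm// sqr_ge0.
Qed.

(** The product is dominated by [f ^+ 2 + g ^+ 2]. *)
Lemma L2_integrableM f g : L2 D f -> L2 D g ->
  lebesgue.-integrable D (EFin \o (fun x => f x * g x)).
Proof.
move=> Lf Lg.
have := integrableD mD (L2_integrable_sqr Lf) (L2_integrable_sqr Lg).
apply: le_integrable => //.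
  by apply/measurable_EFinP; apply: measurable_funM; [case: Lf|case: Lg].
move=> x Dx /=; rewrite lee_fin.
rewrite [leRHS]ger0_norm ?addr_ge0 ?sqr_ge0// normrM.
rewrite -(real_normK (num_real (f x))) -(real_normK (num_real (g x))).
nra.
Qed.

Lemma L2norm2E f : L2 D f -> L2norm2 D f = (ip f f)%:E.
Proof.
move=> Lf; rewrite /L2norm2 /ip /Rintegral fineK.
  by apply: eq_integral => x _; rewrite expr2.
by apply: integrable_fin_num => //; exact: L2_integrableM.
Qed.

Lemma L2P f : measurable_fun D f ->
  lebesgue.-integrable D (EFin \o (fun x => f x ^+ 2)) -> L2 D f.
Proof.
move=> mf /integrableP[_ foo]; split=> //.
apply: le_lt_trans foo; rewrite le_eqVlt; apply/orP; left; apply/eqP.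
by apply: eq_integral => x _ /=; rewrite ger0_norm// sqr_ge0.
Qed.

Lemma L2D f g : L2 D f -> L2 D g -> L2 D (fun x => f x + g x).
Proof.
move=> Lf Lg; have mfg : measurable_fun D (fun x => f x + g x).
  by apply: measurable_funD; [case: Lf|case: Lg].
apply: L2P => //.
have i1 := integrableD mD (L2_integrable_sqr Lf) (L2_integrable_sqr Lg).
have := integrableZl mD 2 i1.
apply: le_integrable => //.
  by apply/measurable_EFinP; exact: measurable_funX.
move=> x Dx /=; rewrite lee_fin.
rewrite ger0_norm ?sqr_ge0// ger0_norm; last first.
  by rewrite pmulr_rge0// addr_ge0 ?sqr_ge0.
(* This gives the domination of [(f + g) ^+ 2] by [2 * (f ^+ 2 + g ^+ 2)]. *)
have := sqr_ge0 (f x - g x); nra.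
Qed.

Lemma L2Z (a : R) f : L2 D f -> L2 D (fun x => a * f x).
Proof.
move=> Lf; apply: L2P.
  by apply: measurable_funM => //; case: Lf.
have := integrableZl mD (a ^+ 2) (L2_integrable_sqr Lf).
by apply: eq_integrable => // x _ /=; rewrite exprMn.
Qed.

Lemma L2N f : L2 D f -> L2 D (fun x => - f x).
Proof.
by move=> /(L2Z (-1)); congr L2; apply/funext => x; rewrite mulN1r.
Qed.

Lemma L2B f g : L2 D f -> L2 D g -> L2 D (fun x => f x - g x).
Proof. by move=> Lf Lg; apply: L2D => //; exact: L2N. Qed.

Lemma L2_cst0 : L2 D (fun=> 0).
Proof.
split=> //; rewrite /L2norm2.
by under eq_integral do rewrite expr0n/=; rewrite integral0.
Qed.

Lemma L2_sum (I : Type) (r : seq I) (F : I -> 'rV[R]_n -> R) :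
  (forall i, L2 D (F i)) -> L2 D (fun x => \sum_(i <- r) F i x).
Proof.
move=> LF; elim: r => [|i r IH].
  by under eq_fun do rewrite big_nil; exact: L2_cst0.
by under eq_fun do rewrite big_cons; exact: L2D.
Qed.

Lemma L2_mulrb f (c : bool) : L2 D f -> L2 D (fun x => f x *+ c).
Proof. by case: c => // _; exact: L2_cst0. Qed.

Lemma ipC f g : ip f g = ip g f.
Proof. by apply: eq_Rintegral => x _; rewrite mulrC. Qed.

Lemma ipDl f g h : L2 D f -> L2 D g -> L2 D h ->
  ip (fun x => f x + g x) h = ip f h + ip g h.
Proof.
move=> Lf Lg Lh; rewrite /ip -RintegralD//; try exact: L2_integrableM.
by apply: eq_Rintegral => x _; rewrite mulrDl.
Qed.

Lemma ipZl a f g : L2 D f -> L2 D g -> ip (fun x => a * f x) g = a * ip f g.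
Proof.
move=> Lf Lg; rewrite /ip -RintegralZl//; last exact: L2_integrableM.
by apply: eq_Rintegral => x _; rewrite mulrA.
Qed.

Lemma ipZr a f g : L2 D f -> L2 D g -> ip g (fun x => a * f x) = a * ip g f.
Proof. by move=> *; rewrite ipC ipZl// ipC. Qed.

Lemma ipNl f g : L2 D f -> L2 D g -> ip (fun x => - f x) g = - ip f g.
Proof.
move=> Lf Lg; rewrite -mulN1r -ipZl//.
by apply: eq_Rintegral => x _; rewrite mulN1r.
Qed.

Lemma ipNr f g : L2 D f -> L2 D g -> ip g (fun x => - f x) = - ip g f.
Proof. by move=> *; rewrite ipC ipNl// ipC. Qed.

Lemma ipBl f g h : L2 D f -> L2 D g -> L2 D h ->
  ip (fun x => f x - g x) h = ip f h - ip g h.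
Proof. by move=> Lf Lg Lh; rewrite ipDl ?ipNl//; exact: L2N. Qed.

Lemma ipDr f g h : L2 D f -> L2 D g -> L2 D h ->
  ip h (fun x => f x + g x) = ip h f + ip h g.
Proof. by move=> *; rewrite ipC ipDl// ![ip _ h]ipC. Qed.

Lemma ipBr f g h : L2 D f -> L2 D g -> L2 D h ->
  ip h (fun x => f x - g x) = ip h f - ip h g.
Proof. by move=> *; rewrite ipC ipBl// ![ip _ h]ipC. Qed.

Lemma ip0l f : ip (fun=> 0) f = 0.
Proof.
rewrite /ip (@eq_Rintegral _ _ _ _ _ (fun=> 0)); last by move=> x _; rewrite mul0r.
by rewrite Rintegral_cst// mul0r.
Qed.

Lemma ip0r f : ip f (fun=> 0) = 0.
Proof. by rewrite ipC ip0l. Qed.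

Lemma ip_suml (I : Type) (r : seq I) (F : I -> 'rV[R]_n -> R) g :
  (forall i, L2 D (F i)) -> L2 D g ->
  ip (fun x => \sum_(i <- r) F i x) g = \sum_(i <- r) ip (F i) g.
Proof.
move=> LF Lg; elim: r => [|i r IH].
  by rewrite big_nil; under eq_fun do rewrite big_nil; exact: ip0l.
rewrite big_cons -IH -ipDl//; last exact: L2_sum.
by apply: eq_Rintegral => x _; rewrite big_cons.
Qed.

Lemma ip_ge0 f : 0 <= ip f f.
Proof. by apply: Rintegral_ge0 => x _; rewrite -expr2 sqr_ge0. Qed.

Lemma ip_ae f g h : L2 D f -> L2 D g -> L2 D h ->
  {ae lebesgue, forall x, D x -> f x = g x} -> ip f h = ip g h.
Proof.
move=> Lf Lg Lh fg; rewrite /ip /Rintegral; congr fine.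
apply: ae_eq_integral => //.
- by apply/measurable_EFinP; apply: measurable_funM; [case: Lf|case: Lh].
- by apply/measurable_EFinP; apply: measurable_funM; [case: Lg|case: Lh].
- by apply: filterS fg => x fgx Dx; rewrite fgx.
Qed.

Lemma ip_sqrD f g : L2 D f -> L2 D g ->
  ip (fun x => f x + g x) (fun x => f x + g x) =
  ip f f + 2 * ip f g + ip g g.
Proof.
move=> Lf Lg; have Lfg := L2D Lf Lg.
by rewrite ipDl// !ipDr// [ip g f]ipC; lra.
Qed.

Lemma cauchy_schwarz f g : L2 D f -> L2 D g ->
  ip f g ^+ 2 <= ip f f * ip g g.
Proof.
move=> Lf Lg; have H t : 0 <= ip f f + 2 * t * ip f g + t ^+ 2 * ip g g.
  have := ip_ge0 (fun x => f x + t * g x).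
  have Ltg := L2Z t Lg.
  by rewrite ip_sqrD// ipZl// !ipZr//; lra.
have := ip_ge0 g; rewrite le_eqVlt => /predU1P[g0|g0]; last first.
  (* [H] is a nonnegative quadratic polynomial in [t], evaluated here at its minimum. *)
  have := H (- ip f g / ip g g).
  set a := ip f f; set c := ip f g; set b := ip g g in g0 *.
  have b0 : b != 0 by rewrite gt_eqF.
  rewrite (_ : _ + _ = a - c ^+ 2 / b); last by field.
  by rewrite subr_ge0 ler_pdivrMr.
rewrite -g0 mulr0.
have [->|c0] := eqVneq (ip f g) 0; first by rewrite expr0n.
(* With [ip g g = 0] the polynomial is affine with nonzero slope, and this [t] would give it the
   value -1. *)
have := H (- (ip f f + 1) / (2 * ip f g)).
rewrite -g0 mulr0 addr0 (_ : _ + _ = -1); first by lra.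
by field.
Qed.

Lemma cauchy_schwarz_sqrt f g : L2 D f -> L2 D g ->
  `|ip f g| <= Num.sqrt (ip f f) * Num.sqrt (ip g g).
Proof.
move=> Lf Lg; rewrite -sqrtrM ?ip_ge0// -sqrtr_sqr.
by apply: ler_wsqrtr; exact: cauchy_schwarz.
Qed.

(** The parallelogram identity, with the square of the difference dropped. *)
Lemma ip_sqrD_le f g : L2 D f -> L2 D g ->
  ip (fun x => f x + g x) (fun x => f x + g x) <= 2 * ip f f + 2 * ip g g.
Proof.
move=> Lf Lg; rewrite ip_sqrD//; have := ip_ge0 (fun x => f x - g x).
have LNg := L2N Lg.
by rewrite !ip_sqrD// ipNl// !ipNr//; lra.
Qed.

Definition cvgL2 (f_ : nat -> 'rV[R]_n -> R) f : Prop :=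
  (fun k => ip (fun x => f_ k x - f x) (fun x => f_ k x - f x)) @ \oo --> 0.

(** This passes from the extended-real norms in the definition of the trace to real inner
    products. *)
Lemma cvgL2P (f_ : nat -> 'rV[R]_n -> R) f : (forall k, L2 D (f_ k)) -> L2 D f ->
  (fun k => L2norm2 D (f_ k \- f)) @ \oo --> 0%E <-> cvgL2 f_ f.
Proof.
move=> Lf_ Lf; have e : (fun k => L2norm2 D (f_ k \- f)) =
    EFin \o (fun k => ip (fun x => f_ k x - f x) (fun x => f_ k x - f x)).
  by apply/funext => k; rewrite L2norm2E//; exact: L2B.
by rewrite e; split => [/fine_cvgP[_]|] // h; apply/fine_cvgP; split => //; near=> k.
Unshelve. all: by end_near. Qed.

Lemma cvg_ip (f_ g_ : nat -> 'rV[R]_n -> R) f g :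
  (forall k, L2 D (f_ k)) -> L2 D f -> (forall k, L2 D (g_ k)) -> L2 D g ->
  cvgL2 f_ f -> cvgL2 g_ g -> (fun k => ip (f_ k) (g_ k)) @ \oo --> ip f g.
Proof.
move=> Lf_ Lf Lg_ Lg ff gg.
pose a k := Num.sqrt (ip (fun x => f_ k x - f x) (fun x => f_ k x - f x)).
pose c k := Num.sqrt (ip (fun x => g_ k x - g x) (fun x => g_ k x - g x)).
have a0 : a @ \oo --> 0.
  by rewrite -(@sqrtr0 R); apply: continuous_cvg => //; exact: sqrt_continuous.
have c0 : c @ \oo --> 0.
  by rewrite -(@sqrtr0 R); apply: continuous_cvg => //; exact: sqrt_continuous.
(* By Cauchy-Schwarz [e k] bounds the three terms obtained by expanding around the limits [f] and
   [g]. *)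
pose e k := a k * c k + a k * Num.sqrt (ip g g) + Num.sqrt (ip f f) * c k.
have e0 : e @ \oo --> 0.
  rewrite (_ : 0 = 0 * 0 + 0 * Num.sqrt (ip g g) + Num.sqrt (ip f f) * 0).
    by apply: cvgD; [apply: cvgD; apply: cvgM => //; exact: cvg_cst
      | apply: cvgM => //; exact: cvg_cst].
  by rewrite !mul0r mulr0 !addr0.
have Ie k : `|ip (f_ k) (g_ k) - ip f g| <= e k.
  have Lfk := L2B (Lf_ k) Lf; have Lgk := L2B (Lg_ k) Lg.
  rewrite (_ : _ - _ = ip (fun x => f_ k x - f x) (fun x => g_ k x - g x) +
    ip (fun x => f_ k x - f x) g + ip f (fun x => g_ k x - g x)); last first.
    by rewrite ipBr// !ipBl// ipBr//; lra.
  apply: (le_trans (ler_normD _ _)); apply: lerD; last exact: cauchy_schwarz_sqrt.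
  apply: (le_trans (ler_normD _ _)); apply: lerD; exact: cauchy_schwarz_sqrt.
apply/cvgrPdist_le => r r0.
move/cvgrPdist_le : e0 => /(_ r r0); apply: filterS => k.
rewrite sub0r normrN distrC => /(le_trans (ler_norm _)).
exact/le_trans/Ie.
Qed.

End L2_space.

(** * Lebesgue measure on R^n *)

Section continuous_measurable_rV.
Context {R : realType} {n : nat}.

Let grid (k : nat) (x : 'rV[R]_n) : 'rV[int]_n :=
  \row_i Num.floor (k.+1%:R * x 0 i).

Let grid_pt (k : nat) (z : 'rV[int]_n) : 'rV[R]_n :=
  \row_i ((z 0 i)%:~R / k.+1%:R).

Let measurable_grid k z : measurable [set x | grid k x = z].
Proof.
rewrite (_ : [set x | _] = \bigcap_(i in [set: 'I_n])
    (rV_coord i @^-1` [set t | (z 0 i)%:~R <= k.+1%:R * t < (z 0 i)%:~R + 1])).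
  apply: fin_bigcap_measurable => // i _.
  rewrite -[X in measurable X]setTI; apply: measurable_rV_coord => //.
  rewrite (_ : [set t | _] = (fun t : R => k.+1%:R * t) @^-1`
    `[(z 0 i)%:~R, (z 0 i)%:~R + 1[); last first.
    by apply/seteqP; split => t /=; rewrite in_itv.
  by rewrite -[X in measurable X]setTI; apply: mulrl_measurable.
apply/seteqP; split => x /=.
  move=> <- i _ /=; rewrite mxE.
  by have := floor_itv (k.+1%:R * x 0 i); rewrite intrD.
move=> H; apply/rowP => i; rewrite mxE; apply: floor_def.
by have := H i I; rewrite /= /rV_coord intrD.
Qed.

Let cvg_grid x : (fun k => grid_pt k (grid k x)) @ \oo --> x.
Proof.
apply/cvg_ballP => e e0; have [N _ NE] := near_infty_natSinv_lt (PosNum e0).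
exists N => // k /NE /= ke; split=> // i j; rewrite !mxE ord1.
rewrite -ball_normE /=; have := floor_itv (k.+1%:R * x 0 j); rewrite intrD.
set z := (Num.floor _)%:~R => /andP[z1 z2].
have : 0 < k.+1%:R :> R by rewrite ltr0n.
move: z1 z2 ke; set K := k.+1%:R => z1 z2 ke k0.
rewrite (_ : _ - _ = (K * x 0 j - z) / K); last first.
  by field; rewrite gt_eqF.
rewrite ger0_norm ?divr_ge0// ?subr_ge0//.
by apply: le_lt_trans ke; rewrite ler_piMl ?invr_ge0// lerBlDl ltW// addrC.
Qed.

(** The sigma-algebra is generated by the coordinates, so measurability does not come from open sets
    directly. Rounding each coordinate down to a multiple of [1 / k.+1] gives functions constant on
    countably many measurable cells, and by continuity their values converge to [f x]. *)
Lemma continuous_measurable_rV (f : 'rV[R]_n -> R) :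
  continuous f -> measurable_fun setT f.
Proof.
move=> cf; apply: (@measurable_fun_cvg _ _ _ _ (fun k x => f (grid_pt k (grid k x)))).
  move=> k _ Y mY; rewrite setTI.
  rewrite (_ : _ @^-1` Y = \bigcup_(z in [set: 'rV[int]_n])
     (if `[< Y (f (grid_pt k z)) >] then [set x | grid k x = z] else set0)).
    by apply: countable_bigcupT_measurable => [|z]; [exact: countableP|case: ifP].
  apply/seteqP; split => x /=.
    by move=> Yx; exists (grid k x) => //; rewrite asboolT.
  by move=> [z _]; case: asboolP => // Yz /= ->.
move=> x _.
exact: cvg_trans (cvg_app f (@cvg_grid x)) (cf x).
Qed.

End continuous_measurable_rV.

(** * Fubini with the last coordinate singled out *)

Section at_height_lemmas.
Context {R : realType}.

Lemma at_heightE m (t : R) (y : 'rV[R]_m) : at_height t y 0 ord_max = t.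
Proof. by rewrite mxE unlift_none. Qed.

Lemma at_height_lift m (t : R) (y : 'rV[R]_m) j :
  at_height t y 0 (lift ord_max j) = y 0 j.
Proof. by rewrite mxE liftK. Qed.

(** [lebesgue] is built by adjoining a first coordinate whereas the slab is cut in the last one.
    That the two insertions commute is what the induction in [tonelli_at_height] rests on. *)
Lemma at_height_rV_cons m (t : R) z :
  at_height t (rV_cons z) = rV_cons (z.1, at_height t z.2) :> 'rV[R]_m.+2.
Proof.
apply/rowP => j; case: (unliftP ord0 j) => [k|] ->.
  rewrite [RHS]rV_consES /rV_coord /=; case: (unliftP ord_max k) => [l|] ->.
    rewrite at_height_lift (_ : lift ord0 _ = lift ord_max (lift ord0 l)).
      by rewrite at_height_lift; exact: rV_consES.
    apply/val_inj => /=; rewrite /bump !leq0n /=.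
    by rewrite [(m <= l)%N]leqNgt [(m.+1 <= _)%N]leqNgt !add1n ltnS !ltn_ord.
  by rewrite at_heightE (_ : lift ord0 _ = ord_max) ?at_heightE//; exact/val_inj.
rewrite [RHS]rV_consE0 /= (_ : ord0 = lift ord_max ord0); last exact/val_inj.
by rewrite at_height_lift; exact: rV_consE0.
Qed.

Lemma measurable_at_height2 m :
  measurable_fun setT
    (fun z : 'rV[R]_m * measurableTypeR R => at_height (z.2 : R) z.1).
Proof.
apply: measurable_fun_rVP => i; case: (unliftP ord_max i) => [j|] ->.
  rewrite (_ : _ \o _ = rV_coord j \o fst).
    by apply: measurableT_comp => //; exact: measurable_rV_coord.
  by apply/funext => z; exact: at_height_lift.
rewrite (_ : _ \o _ = snd); first exact: measurable_snd.
by apply/funext => z; exact: at_heightE.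
Qed.

Lemma measurable_slab m (b : R) : measurable (@slab R m b).
Proof.
rewrite (_ : slab b = rV_coord ord_max @^-1` `]0, b[).
  by rewrite -[X in measurable X]setTI; apply: measurable_rV_coord.
by apply/seteqP; split => x; rewrite /slab /= in_itv.
Qed.

Local Open Scope ereal_scope.

Lemma integral_lebesgueS m (F : 'rV[R]_m.+1 -> \bar R) :
  measurable_fun setT F -> (forall x, 0 <= F x) ->
  \int[lebesgue]_x F x =
  \int[lebesgue_measure]_t \int[lebesgue]_y F (rV_cons (t, y)).
Proof.
move=> mF F0; have mFc : measurable_fun setT (F \o rV_cons).
  by apply: measurableT_comp => //; exact: measurable_rV_cons.
rewrite -(fubini_tonelli1 (F \o rV_cons))//.
rewrite [LHS]ge0_integral_pushforward//; last exact: measurable_rV_cons.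
by move=> x; exact: F0.
Qed.

Lemma measurable_comp_at_height m (F : 'rV[R]_m.+1 -> \bar R) :
  measurable_fun setT F ->
  measurable_fun setT
    (fun z : 'rV[R]_m * measurableTypeR R => F (at_height (z.2 : R) z.1)).
Proof. by move=> mF; apply: measurableT_comp mF (@measurable_at_height2 m). Qed.

Lemma tonelli_at_height m (F : 'rV[R]_m.+1 -> \bar R) :
  measurable_fun setT F -> (forall x, 0 <= F x) ->
  \int[lebesgue]_x F x =
  \int[lebesgue]_y \int[lebesgue_measure]_t F (at_height t y).
Proof.
elim: m F => [|m IH] F mF F0.
  (* In dimension one the first and last coordinates coincide, and the remaining factor is a Dirac
     mass at the only point. *)
  rewrite integral_lebesgueS// integral_dirac//; last first.
    exact: (measurable_fun_fubini_tonelli_F _ (measurable_comp_at_height mF)).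
  rewrite diracT mul1e; apply: eq_integral => t _.
  rewrite integral_dirac//; last first.
    by apply: measurableT_comp mF _; apply: measurableT_comp measurable_rV_cons _.
  rewrite diracT mul1e; congr F; apply/rowP => j.
  case: (unliftP ord_max j) => [[]//|] ->; rewrite at_heightE.
  by rewrite -[RHS](rV_consE0 (t, 0%R : 'rV[R]_0)); congr rV_coord; exact/val_inj.
rewrite !integral_lebesgueS//; last 2 first.
- exact: (measurable_fun_fubini_tonelli_F _ (measurable_comp_at_height mF)).
- by move=> y; apply: integral_ge0.
apply: eq_integral => t _; rewrite IH//.
  apply: eq_integral => y _; apply: eq_integral => s _.
  by rewrite at_height_rV_cons.
by apply: measurableT_comp mF _; apply: measurableT_comp measurable_rV_cons _.
Qed.

Lemma tonelli_prod_at_height m (F : 'rV[R]_m.+1 -> \bar R) :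
  measurable_fun setT F -> (forall x, 0 <= F x) ->
  \int[lebesgue]_x F x =
  \int[@lebesgue R m \x @lebesgue_measure R]_z F (at_height z.2 z.1).
Proof.
move=> mF F0; rewrite tonelli_at_height//.
rewrite [RHS]fubini_tonelli1//; first exact: measurable_comp_at_height.
Qed.

(** Tonelli carries the positive and negative parts to the product measure, where the standard
    Fubini theorem applies. *)
Lemma fubini_at_height m (F : 'rV[R]_m.+1 -> \bar R) :
  lebesgue.-integrable setT F ->
  \int[lebesgue]_x F x =
  \int[lebesgue]_y \int[lebesgue_measure]_t F (at_height t y).
Proof.
move=> iF; have mF := measurable_int _ iF.
rewrite [RHS](@integral12_prod_meas1 _ _ _ _ _ lebesgue lebesgue_measure
  (fun z : 'rV[R]_m * measurableTypeR R => F (at_height (z.2 : R) z.1))).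
  rewrite integralE [RHS]integralE.
  rewrite (tonelli_prod_at_height (measurable_funepos mF))//.
  rewrite (tonelli_prod_at_height (measurable_funeneg mF))//.
  by congr (_ - _); apply: eq_integral => z _; rewrite ?funeposE ?funenegE.
have mFz := measurable_comp_at_height mF.
apply/integrableP; split => //.
have /integrableP[_] := iF.
by rewrite tonelli_prod_at_height//; exact: measurableT_comp.
Qed.

End at_height_lemmas.

(** * Continuous functions of bounded support *)

Section bounded_support.
Context {R : realType}.

(** This condition survives multiplication by an arbitrary function, differentiation and restriction
    to a hyperplane. It lets [ftc_slab] apply to products such as [x_n phi^2] that are not shown to
    be test functions. *)
Definition bounded_support n (f : 'rV[R]_n -> R) : Prop :=
  exists M : R, forall x, M < `|x| -> f x = 0.

Lemma test_fun_bounded_support n (D : set 'rV[R]_n) f :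
  test_fun D f -> bounded_support f.
Proof.
move=> [_ [K [cK _ fK]]]; have [M [_ KM]] := compact_bounded cK.
exists (M + 1) => x Mx; apply: fK => Kx.
have MM1 : M < M + 1 by rewrite ltrDl.
by have := KM _ MM1 x Kx; rewrite /= leNgt Mx.
Qed.

Lemma ler_coord_norm n (x : 'rV[R]_n) i : `|x 0 i| <= `|x|.
Proof.
have /mapP[j Hj ->] : `|x 0 i| \in [seq `|x x0.1 x0.2| | x0 : 'I_1 * 'I_n].
  by apply/mapP; exists (0, i) => //=; rewrite mem_enum.
by rewrite [leRHS]/Num.norm /= mx_normrE; apply/bigmax_geP; right => /=; exists j.
Qed.

Let box n (M : R) : set 'rV[R]_n := [set x | forall i, x 0 i \in `[- M, M]].

Let measurable_box n M : measurable (@box n M).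
Proof.
rewrite (_ : box _ = \bigcap_(i in [set: 'I_n]) (rV_coord i @^-1` `[- M, M])).
  apply: fin_bigcap_measurable => // i _.
  by rewrite -[X in measurable X]setTI; apply: measurable_rV_coord.
by apply/seteqP; split => x /= H i; [move=> _; exact: H|exact: H].
Qed.

Let lebesgue_box n M : (lebesgue (@box n M) < +oo)%E.
Proof.
elim: n => [|n IH]; first by rewrite /= diracE ltry.
rewrite /= /lebesgue_cons /pushforward.
rewrite (_ : _ @^-1` _ = `[- M, M]%classic `*` box M).
  rewrite product_measure1E//; last exact: measurable_box.
  by rewrite lte_mul_pinfty//= lebesgue_measure_itv/=; case: ifP.
apply/seteqP; split => [z|z [z1 z2]].
  move=> zM; split; first by have := zM ord0; rewrite -/(rV_coord _ _) rV_consE0.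
  by move=> i; have := zM (lift ord0 i); rewrite -/(rV_coord _ _) rV_consES.
move=> i; rewrite -/(rV_coord _ _).
case: (unliftP ord0 i) => [j|] ->; first by rewrite rV_consES; exact: z2.
by rewrite rV_consE0.
Qed.

Lemma continuous_bounded_support_bounded n (f : 'rV[R]_n -> R) :
  continuous f -> bounded_support f -> exists C, forall x, `|f x| <= C.
Proof.
move=> cf [M fM].
have cB : compact (closed_ball_ Num.norm (0 : 'rV[R]_n) M).
  apply: bounded_closed_compact; last exact: closed_closed_ball_.
  exists M; split; first exact: num_real.
  by move=> r Mr x; rewrite /closed_ball_ /= sub0r normrN => /le_trans; apply; exact: ltW.
have /compact_bounded[C [_ HC]] : compact (f @` closed_ball_ Num.norm (0 : 'rV[R]_n) M).
  by apply: continuous_compact => //; apply: continuous_subspaceT.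
exists (`|C| + 1) => x; have [xM|xM] := leP `|x| M.
  apply: (HC (`|C| + 1)); first by rewrite (le_lt_trans (ler_norm _))// ltrDl.
  by exists x => //; rewrite /closed_ball_ /= sub0r normrN.
by rewrite fM// normr0 addr_ge0.
Qed.

(** The function is bounded and vanishes off a box, whose measure is finite by induction on the
    dimension. *)
Lemma continuous_bounded_support_integrable n (D : set 'rV[R]_n) f :
  measurable D -> continuous f -> bounded_support f ->
  lebesgue.-integrable D (EFin \o f).
Proof.
move=> mD cf sf; have [C fC] := continuous_bounded_support_bounded cf sf.
have [M fM] := sf.
have mf := continuous_measurable_rV cf.
apply: (integrableS measurableT) => //.
have -> : EFin \o f = (EFin \o f) \_ (box M).
  apply/funext => x; rewrite patchE; case: ifPn => // /negP xB /=.
  rewrite fM// ltNge; apply/negP => xM; apply: xB; rewrite inE => i.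
  by rewrite in_itv/= -ler_norml (le_trans (ler_coord_norm _ _)).
apply/(integrable_mkcond _ (measurable_box _)).1.
apply: measurable_bounded_integrable.
- exact: measurable_box.
- exact: lebesgue_box.
- exact: measurable_funTS.
exists C; split; first exact: num_real.
by move=> r Cr x _; exact: le_trans (fC x) (ltW Cr).
Qed.

Lemma bounded_supportMl n (f g : 'rV[R]_n -> R) :
  bounded_support f -> bounded_support (fun x => f x * g x).
Proof. by move=> [M fM]; exists M => x /fM ->; rewrite mul0r. Qed.

Lemma continuous_bounded_support_L2 n (D : set 'rV[R]_n) f :
  measurable D -> continuous f -> bounded_support f -> L2 D f.
Proof.
move=> mD cf sf; apply: L2P => //.
  by apply: measurable_funTS; exact: continuous_measurable_rV.
under [X in EFin \o X]eq_fun do rewrite expr2.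
apply: continuous_bounded_support_integrable => //; last exact: bounded_supportMl.
by move=> x; apply: continuousM; exact: cf.
Qed.

Lemma bounded_support_pderiv n (f : 'rV[R]_n -> R) i :
  bounded_support f -> bounded_support (pderiv i f).
Proof.
move=> [M fM]; exists M => x Mx; rewrite /pderiv.
rewrite (@near_eq_derive _ _ _ f (cst 0)) ?derive_cst//.
near=> z; apply: fM; near: z.
have : (fun z : 'rV[R]_n => `|z|) @ x --> `|x| by exact: norm_continuous.
by move/cvgr_gt; apply.
Unshelve. all: by end_near. Qed.

Lemma bounded_support_at_height m (f : 'rV[R]_m.+1 -> R) c :
  bounded_support f -> bounded_support (f \o at_height c).
Proof.
move=> [M fM]; exists `|M| => y My /=; apply: fM.
have [i yi] : exists i, `|y| = `|y ord0 i|.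
  have y0 : `|y| != 0 by rewrite gt_eqF// (le_lt_trans _ My).
  have [[j i] yij] := mx_norm_neq0 y0.
  by exists i; rewrite [LHS]yij/= (ord1 j).
rewrite (le_lt_trans (ler_norm _))// (lt_le_trans My)// yi -(at_height_lift c).
exact: ler_coord_norm.
Qed.

Lemma continuous_at_height m (c : R) : continuous (@at_height R m c).
Proof.
move=> y A /= /nbhs_ballP[e e0 eA]; apply/nbhs_ballP; exists e => // z [_ yz].
apply: eA; split=> // i j; case: (unliftP ord_max j) => [k|] ->.
  by rewrite (ord1 i) !at_height_lift; exact: yz.
by rewrite (ord1 i) !at_heightE; exact: ballxx.
Qed.

(** It turns difference quotients in the direction [x_n] into those of a function of one real
    variable. *)
Lemma at_heightD m (t r : R) (y : 'rV[R]_m) :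
  at_height (r + t) y = r *: delta_mx 0 ord_max + at_height t y.
Proof.
apply/rowP => j; rewrite [RHS]mxE; case: (unliftP ord_max j) => [k|] ->.
  rewrite !at_height_lift [X in X + _]mxE mxE eqxx /=.
  by rewrite eq_sym (negbTE (neq_lift _ _)) mulr0 add0r.
by rewrite !at_heightE [X in _ = X + _]mxE mxE !eqxx mulr1.
Qed.


End bounded_support.

(** * The fundamental theorem of calculus across the slab *)

Section ftc_slab.
Context {R : realType} {m : nat}.
Implicit Types theta : 'rV[R]_m.+1 -> R.

Let vert theta (y : 'rV[R]_m) : R -> R := fun t => theta (at_height t y).

Let vert_quot theta y t :
  (fun h : R => h^-1 *: (vert theta y (h *: 1 + t) - vert theta y t)) =
  (fun h => h^-1 *: (theta (h *: delta_mx 0 ord_max + at_height t y) -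
    theta (at_height t y))).
Proof. by apply/funext => h; rewrite /vert -at_heightD -[h *: 1]/(h * 1) mulr1. Qed.

Let derivable_vert theta y t : derivable theta (at_height t y) (delta_mx 0 ord_max) ->
  derivable (vert theta y) t 1.
Proof. by rewrite /derivable [in X in _ -> X]/= vert_quot. Qed.

Let derive_vert theta y t : derive1 (vert theta y) t = pderiv ord_max theta (at_height t y).
Proof. by rewrite derive1E /derive vert_quot. Qed.

Let continuous_vert theta y : continuous theta -> continuous (vert theta y).
Proof.
move=> ct t; apply: (@continuous_comp _ _ _ (fun t => at_height t y) theta); last exact: ct.
move=> A /= /nbhs_ballP[e e0 eA]; apply/nbhs_ballP; exists e => // s ts.
apply: eA; split=> // i j; case: (unliftP ord_max j) => [k|] ->.
  by rewrite (ord1 i) !at_height_lift; exact: ballxx.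
by rewrite (ord1 i) !at_heightE.
Qed.

(** Fubini reduces the claim to the one-variable theorem on each vertical segment. *)
Lemma ftc_slab theta b : 0 < b -> continuous theta ->
  (forall x, derivable theta x (delta_mx 0 ord_max)) ->
  continuous (pderiv ord_max theta) -> bounded_support theta ->
  \int[lebesgue]_(x in slab b) pderiv ord_max theta x =
  \int[lebesgue]_y theta (at_height b y) - \int[lebesgue]_y theta (at_height 0 y).
Proof.
move=> b0 ct dt cdt st.
have sdt := bounded_support_pderiv ord_max st.
have integrable_height c : lebesgue.-integrable setT
    (EFin \o (fun y => theta (at_height c y))).
  apply: continuous_bounded_support_integrable => //.
    by move=> y; apply: (@continuous_comp _ _ _ (at_height c) theta);
      [exact: continuous_at_height|exact: ct].
  exact: bounded_support_at_height.
rewrite -RintegralB//; congr fine.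
rewrite integral_mkcond fubini_at_height; last first.
  apply/(integrable_mkcond _ (measurable_slab _)).1.
  apply: continuous_bounded_support_integrable => //; exact: measurable_slab.
apply: eq_integral => y _.
rewrite [RHS](_ : _ = (vert theta y b)%:E - (vert theta y 0)%:E)%E//.
rewrite -(@continuous_FTC2 _ (vert (pderiv ord_max theta) y))//.
(* The one-variable theorem integrates over the closed segment while the slab is open. The endpoints
   are discarded one at a time. *)
- rewrite -integral_itv_obnd_cbnd; last first.
    apply/measurable_EFinP; apply: measurable_funTS.
    by apply: continuous_measurable_fun; exact: continuous_vert.
  rewrite -integral_itv_bndo_bndc; last first.
    apply/measurable_EFinP; apply: measurable_funTS.
    by apply: continuous_measurable_fun; exact: continuous_vert.
  rewrite [RHS]integral_mkcond; apply: eq_integral => t _.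
  rewrite !patchE; congr (if _ then _ else _).
  by apply/idP/idP; rewrite !inE /slab /= in_itv at_heightE.
- by apply: continuous_subspaceT => t; apply: continuous_vert.
- split; first by move=> t _; apply: derivable_vert.
    by apply: cvg_at_right_filter; exact: continuous_vert.
  by apply: cvg_at_left_filter; exact: continuous_vert.
Qed.

End ftc_slab.

(** * Smooth functions and cutoffs *)

Section flat_exponential.
Context {R : realType}.
Implicit Types t a d c : R.

(** The classical flat function is the case [k = 0]. The powers of [t^-1] are included because
    differentiation produces them. *)
Definition flat (k : nat) (t : R) : R :=
  if 0 < t then t^-1 ^+ k * expR (- t^-1) else 0.

Lemma flat_le0 k t : t <= 0 -> flat k t = 0.
Proof. by rewrite /flat leNgt => /negbTE ->. Qed.

Lemma flat_ge0 k t : 0 <= flat k t.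
Proof.
rewrite /flat; case: ifP => // t0.
by rewrite mulr_ge0 ?expR_ge0// exprn_ge0// invr_ge0 ltW.
Qed.

Lemma flat_le k t : flat k t <= (k.+2)`!%:R * t ^+ 2.
Proof.
rewrite /flat; case: ifP => [t0|_]; last by rewrite mulr_ge0 ?sqr_ge0.
have u0 : 0 < t^-1 by rewrite invr_gt0.
rewrite expRN -ler_pdivlMr ?invr_gt0 ?expR_gt0// invrK.
have := expR_ge1Dxn k.+1 (ltW u0); set E := expR _; set F := (_`!)%:R => H.
have F0 : 0 < F by rewrite ltr0n fact_gt0.
have t0' : t != 0 by rewrite gt_eqF.
have {}H : t^-1 ^+ k.+2 <= F * E.
  by rewrite mulrC -ler_pdivrMr// (le_trans _ H)// lerDr.
rewrite -mulrA [_ ^+ 2 * _]mulrC mulrA -ler_pdivrMr ?exprn_gt0//.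
by rewrite -exprVn -exprD addn2.
Qed.

Lemma is_derive_flat k t :
  is_derive t 1 (flat k) (flat k.+2 t - k%:R * flat k.+1 t).
Proof.
have [t0|t0|->] := ltgtP t 0.
- rewrite !flat_le0 ?ltW// mulr0 subrr.
  apply: (@near_eq_is_derive _ _ _ (cst 0)) => /=.
  near=> s; rewrite flat_le0// ltW//; near: s.
  exact: lt_nbhsl.
- have it : is_derive t 1 (fun s : R => s^-1) (- t ^- 2 *: 1).
    by apply: is_deriveV => //; rewrite gt_eqF.
  have ik := is_deriveX k it.
  have ie : is_derive t 1 (expR \o (fun s : R => - s^-1))
      (expR (- t^-1) * (- (- t ^- 2 *: 1))).
    exact: is_derive1_comp.
  have im := is_deriveM ik ie.
  have t0' : t != 0 by rewrite gt_eqF.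
  apply: (near_eq_is_derive _ (is_derive_eq im _)).
    near=> s; have s0 : 0 < s by near: s; exact: lt_nbhsr.
    by rewrite /flat s0 !fctE.
  rewrite /flat t0 !fctE /=; set E := expR _.
  rewrite -![_ *: _]/(_ * _) !exprVn; case: k ik im => [|k] _ _ /=.
    by rewrite !expr0; field.
  have T0 : t ^+ k != 0 by rewrite expf_neq0.
  move: T0; rewrite !exprS expr0; set T := t ^+ k => T0.
  by field; rewrite T0 t0'.
(* At the origin [flat_le] bounds the difference quotient by a constant times [|h|]. *)
- rewrite !flat_le0// mulr0 subrr.
  have H : (fun h : R => h^-1 *: (flat k (h *: 1 + 0) - flat k 0)) @ 0^' --> (0 : R).
    rewrite flat_le0//; apply/cvgrPdist_le => e e0; near=> h.
    rewrite addr0 -[h *: 1]/(h * 1) mulr1 subr0 sub0r normrN -[_ *: _]/(_ * _).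
    rewrite normrM normfV ler_pdivrMl ?normr_gt0; last by near: h; exact: nbhs_dnbhs_neq.
    rewrite ger0_norm ?flat_ge0// (le_trans (flat_le k h))//.
    rewrite -real_normK ?num_real// expr2 mulrA mulrC ler_wpM2l//.
    rewrite mulrC -ler_pdivlMr ?ltr0n ?fact_gt0//.
    near: h; apply: dnbhs0_le; rewrite divr_gt0// ltr0n fact_gt0//.
  apply: DeriveDef; first by apply/cvg_ex; exists 0.
  exact: cvg_lim H.
Unshelve. all: by end_near. Qed.

Lemma flat0_le1 t : flat 0 t <= 1.
Proof.
rewrite /flat; case: ifP => // t0; rewrite expr0 mul1r expR_le1 oppr_le0.
by rewrite invr_ge0 ltW.
Qed.

Lemma cvg_flat0 (u : nat -> R) : u @ \oo --> +oo -> (fun k => flat 0 (u k)) @ \oo --> (1 : R).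
Proof.
move=> uoo.
have H : (fun k => expR (- (u k)^-1)) @ \oo --> (1 : R).
  rewrite -(@expR0 R) -oppr0; apply: (@cvg_comp _ _ _ (fun k => - (u k)^-1) expR).
    by apply: cvgN; apply/gtr0_cvgV0 => //; move/cvgryPgt : uoo; apply.
  exact: continuous_expR.
apply: cvg_trans H; apply: near_eq_cvg.
move/cvgryPgt : uoo => /(_ 0); apply: filterS => k uk.
by rewrite /flat uk expr0 mul1r.
Qed.

(** Linear combinations of flat functions with affine arguments form a class stable under
    differentiation, as [smooth_ind] requires. *)
Inductive flat_comb : (R -> R) -> Prop :=
| flat_comb_aff k a d : flat_comb (fun t => flat k (a * t + d))
| flat_combZ c f : flat_comb f -> flat_comb (fun t => c * f t)
| flat_combD f g : flat_comb f -> flat_comb g -> flat_comb (fun t => f t + g t).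

Lemma flat_comb_derivable f : flat_comb f ->
  exists2 f', flat_comb f' & forall t, is_derive t 1 f (f' t).
Proof.
elim=> [k a d|c f0 _ [f' Sf' df']|f0 g0 _ [f' Sf' df'] _ [g' Sg' dg']].
- exists (fun t => a * (flat k.+2 (a * t + d) + (- k%:R) * flat k.+1 (a * t + d))).
    by apply: flat_combZ; apply: flat_combD;
      [|apply: flat_combZ]; exact: flat_comb_aff.
  move=> t; have ia : is_derive t (1 : R) (fun s : R => a * s + d) a.
    have := @is_deriveD _ _ _ (fun s : R => a *: s) (cst d) t 1 _ _
       (is_deriveZ a (is_derive_id t 1)) (is_derive_cst d t 1).
    by move/is_derive_eq; apply; rewrite addr0 -[_ *: _]/(_ * _) mulr1.
  have := @is_derive1_comp _ (flat k) (fun s => a * s + d) t _ _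
    (is_derive_flat k (a * t + d)) ia.
  by move/is_derive_eq; apply; rewrite mulrC mulNr.
- exists (fun t => c * f' t); first exact: flat_combZ.
  by move=> t; exact: (is_deriveZ c (df' t)).
- exists (fun t => f' t + g' t); first exact: flat_combD.
  by move=> t; exact: (is_deriveD (df' t) (dg' t)).
Qed.

End flat_exponential.

Section smooth_functions.
Context {R : realType} {n : nat}.
Implicit Types (f g phi : 'rV[R]_n -> R) (i j : 'I_n).

(** A coinduction principle: smoothness follows from membership in a class of continuous, partially
    derivable functions that is stable under partial derivatives. *)
Lemma smooth_ind (S : ('rV[R]_n -> R) -> Prop) :
  (forall f, S f -> [/\ continuous f,
     (forall i x, derivable f x (delta_mx 0 i)) & forall i, S (pderiv i f)]) ->
  forall f, S f -> smooth f.
Proof.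
move=> HS f Sf l; have : S (foldr pderiv f l).
  by elim: l => //= i l IH; have [_ _] := HS _ IH; exact.
by move=> /HS[].
Qed.

Lemma smooth_continuous f : smooth f -> continuous f.
Proof. by move=> /(_ [::])[]. Qed.

Lemma smooth_derivable f i x : smooth f -> derivable f x (delta_mx 0 i).
Proof. by move=> /(_ [::])[_]; apply. Qed.

Lemma smooth_pderiv f i : smooth f -> smooth (pderiv i f).
Proof. by move=> sf l; rewrite -foldr_rcons; exact: sf. Qed.

Lemma pderivB f g i : smooth f -> smooth g ->
  pderiv i (fun x => f x - g x) = (fun x => pderiv i f x - pderiv i g x).
Proof.
by move=> sf sg; apply/funext => x; apply: deriveB; exact: smooth_derivable.
Qed.

Lemma pderivM f g i : smooth f -> smooth g ->
  pderiv i (fun x => f x * g x) =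
  (fun x => pderiv i f x * g x + f x * pderiv i g x).
Proof.
move=> sf sg; apply/funext => x; rewrite /pderiv deriveM; last 2 first.
- exact: smooth_derivable.
- exact: smooth_derivable.
by rewrite addrC -[_ *: 'D__ f x]/(_ * _) mulrC.
Qed.

Lemma smoothB f g : smooth f -> smooth g -> smooth (fun x => f x - g x).
Proof.
move=> sf sg; pose S h := exists f1 g1, [/\ smooth f1, smooth g1 & h = fun x => f1 x - g1 x].
apply: (@smooth_ind S); last by exists f, g.
move=> _ [f1 [g1 [sf1 sg1 ->]]]; split.
- by move=> x; apply: continuousB; exact: smooth_continuous.
- by move=> i x; apply: derivableB; exact: smooth_derivable.
- by move=> i; rewrite pderivB//; exists (pderiv i f1), (pderiv i g1);
    split=> //; exact: smooth_pderiv.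
Qed.

(** Products alone are not stable under derivatives, but finite sums of products of smooth functions
    are: by the Leibniz rule each pair of factors yields two pairs. *)
Lemma smoothM f g : smooth f -> smooth g -> smooth (fun x => f x * g x).
Proof.
move=> sf sg.
pose F (s : seq (('rV[R]_n -> R) * ('rV[R]_n -> R))) x := \sum_(p <- s) p.1 x * p.2 x.
pose S h := exists2 s, (forall p, List.In p s -> smooth p.1 /\ smooth p.2) & h = F s.
apply: (@smooth_ind S); last first.
  exists [:: (f, g)]; first by move=> p [<-|//].
  by apply/funext => x; rewrite /F big_seq1.
have F0 : F [::] = cst 0 by apply/funext => x; rewrite /F big_nil.
have FS p s : F (p :: s) = (fun x => p.1 x * p.2 x) \+ F s.
  by apply/funext => x; rewrite /F big_cons.
move=> _ [s + ->]; elim: s => [_|p s IH Hs].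
  rewrite F0; split.
  - by move=> x; exact: (@cst_continuous _ _ 0).
  - by move=> i x; exact: derivable_cst.
  - move=> i; exists [::] => //; rewrite F0; apply/funext => x.
    exact: derive_cst.
have [sp1 sp2] : smooth p.1 /\ smooth p.2 by apply: Hs; left.
have [cs ds Ss] := IH (fun q qs => Hs q (or_intror qs)).
have dp i x : derivable (fun x => p.1 x * p.2 x) x (delta_mx 0 i).
  by apply: derivableM; exact: smooth_derivable.
rewrite FS; split.
- move=> x; apply: continuousD; last exact: cs.
  by apply: continuousM; exact: smooth_continuous.
- by move=> i x; apply: derivableD => //; exact: ds.
- move=> i; have [s' Hs' e] := Ss i.
  exists ((pderiv i p.1, p.2) :: (p.1, pderiv i p.2) :: s').
    move=> q /= [<-|[<-|/Hs'//]]; split => //=; exact: smooth_pderiv.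
  rewrite !FS -e; apply/funext => x; rewrite {1}/pderiv deriveD//.
  rewrite -[X in X + _]/(pderiv i (fun x => p.1 x * p.2 x) x) pderivM//=.
  by rewrite addrA.
Qed.

Lemma pderiv_eq0 (A : set 'rV[R]_n) f i : open A ->
  (forall x, A x -> f x = 0) -> forall x, A x -> pderiv i f x = 0.
Proof.
move=> oA fA x Ax; rewrite /pderiv (@near_eq_derive _ _ _ f (cst 0)) ?derive_cst//.
by near=> z; apply: fA; near: z; exact: open_nbhs_nbhs.
Unshelve. all: by end_near. Qed.

Lemma test_fun_pderiv D f i : test_fun D f -> test_fun D (pderiv i f).
Proof.
move=> [sf [K [cK KD fK]]]; split; first exact: smooth_pderiv.
exists K; split=> // x Kx; apply: (@pderiv_eq0 (~` K)) => //.
by apply: closed_openC; apply: compact_closed => //; exact: norm_hausdorff.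
Qed.

Lemma test_funB D f g : test_fun D f -> test_fun D g ->
  test_fun D (fun x => f x - g x).
Proof.
move=> [sf [K [cK KD fK]]] [sg [L [cL LD gL]]]; split; first exact: smoothB.
exists (K `|` L); split; [exact: compactU|by rewrite subUset|].
by move=> x /not_orP[/fK -> /gL ->]; rewrite subrr.
Qed.

Lemma test_fun_continuous D f : test_fun D f -> continuous f.
Proof. by move=> [sf _]; exact: smooth_continuous. Qed.

Lemma test_fun_L2 D E f : measurable D -> test_fun E f -> L2 D f.
Proof.
move=> mD tf; apply: continuous_bounded_support_L2 => //.
  exact: test_fun_continuous tf.
exact: test_fun_bounded_support tf.
Qed.

End smooth_functions.

Section cutoff.
Context {R : realType}.

Lemma is_derive_coord n (g : R -> R) i j (x : 'rV[R]_n) l :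
  is_derive (x 0 j) 1 g l ->
  is_derive x (delta_mx 0 i) (fun x : 'rV[R]_n => g (x 0 j)) ((i == j)%:R * l).
Proof.
move=> [dg <-]; have e : (fun h : R => h^-1 *: (g ((h *: delta_mx 0 i + x) 0 j) - g (x 0 j)))
    = (fun h => h^-1 *: (g (h *: ((i == j)%:R : R) + x 0 j) - g (x 0 j))).
  by apply/funext => h; rewrite !mxE eqxx eq_sym.
move: e; case: (i == j) => e; last first.
  have {}e : (fun h : R => h^-1 *: (g ((h *: delta_mx 0 i + x) 0 j) - g (x 0 j))) = cst 0.
    by rewrite e; apply/funext => h; rewrite scaler0 add0r subrr scaler0.
  rewrite mul0r; apply: DeriveDef; rewrite /derivable /derive e.
    exact: is_cvg_cst.
  by apply: cvg_lim => //; exact: cvg_cst.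
by rewrite mul1r; apply: DeriveDef; rewrite /derivable /derive e.
Qed.

Lemma smooth_flat_comb n (g : R -> R) (j : 'I_n) : flat_comb g ->
  smooth (fun x : 'rV[R]_n => g (x 0 j)).
Proof.
move=> Sg; pose S (h : 'rV[R]_n -> R) := exists2 g, flat_comb g & h = (fun x => g (x 0 j)).
apply: (@smooth_ind _ _ S); last by exists g.
move=> _ [{Sg}g /flat_comb_derivable[g' Sg' dg] ->]; split.
- move=> x; apply: (@continuous_comp _ _ _ (fun x : 'rV[R]_n => x 0 j) g).
    exact: coord_continuous.
  by apply/differentiable_continuous/derivable1_diffP; case: (dg (x 0 j)).
- by move=> i x; case: (is_derive_coord i (dg (x 0 j))).
- move=> i; exists (fun t => (i == j)%:R * g' t); first exact: flat_combZ.
  by apply/funext => x; case: (is_derive_coord i (dg (x 0 j))).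
Qed.

Context {m : nat}.
Implicit Types (b : R) (x : 'rV[R]_m.+1).

(** Since [flat 0] vanishes on nonpositive numbers and tends to 1 at infinity, this is zero within
    distance [1 / k.+1] of either face and tends to 1 at every point of the slab. It depends on
    [x_n] only. *)
Definition cutoff b (k : nat) x : R :=
  flat 0 (k.+1%:R * x 0 ord_max - 1) * flat 0 (k.+1%:R * (b - x 0 ord_max) - 1).

Let cutoffE b k : cutoff b k =
  (fun x => flat 0 (k.+1%:R * x 0 ord_max + -1) *
    flat 0 ((- k.+1%:R) * x 0 ord_max + (k.+1%:R * b - 1))).
Proof.
by apply/funext => x; congr (_ * flat 0 _); rewrite mulrBr mulNr; lra.
Qed.

Let smooth_aff k (a d : R) : smooth (fun x => flat k (a * x 0 ord_max + d)).
Proof. exact: (smooth_flat_comb _ (flat_comb_aff k a d)). Qed.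

Lemma smooth_cutoff b k : smooth (cutoff b k).
Proof. by rewrite cutoffE; apply: smoothM; exact: smooth_aff. Qed.

Lemma pderiv_cutoff b k j : j != ord_max -> pderiv j (cutoff b k) = (fun=> 0).
Proof.
have H a d x : j != ord_max ->
    pderiv j (fun x => flat 0 (a * x 0 ord_max + d)) x = 0.
  move=> /negbTE jn; have [f' _ df] := flat_comb_derivable (flat_comb_aff 0 a d).
  have [_] := is_derive_coord j (df (x 0 ord_max)).
  by rewrite jn mul0r.
move=> jn; rewrite cutoffE pderivM//; apply/funext => x.
by rewrite !H// mul0r mulr0 addr0.
Qed.

Lemma cutoff_ge0 b k x : 0 <= cutoff b k x.
Proof. by rewrite mulr_ge0// flat_ge0. Qed.

Lemma cutoff_le1 b k x : cutoff b k x <= 1.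
Proof. by rewrite mulr_ile1 ?flat_ge0 ?flat0_le1. Qed.

Lemma cvg_cutoff b x : slab b x -> (fun k => cutoff b k x) @ \oo --> (1 : R).
Proof.
have H (c : R) : 0 < c -> (fun k => k.+1%:R * c - 1) @ \oo --> +oo.
  move=> c0; apply/cvgryPge => A; near=> k.
  rewrite lerBrDr -ler_pdivrMr// (@le_trans _ _ k%:R)// ?ler_nat//.
  by near: k; exact: nbhs_infty_ger.
move=> /andP[x0 xb]; rewrite -[X in _ --> X]mulr1.
by apply: cvgM; apply: cvg_flat0; apply: H; rewrite ?subr_gt0.
Unshelve. all: by end_near. Qed.

Lemma test_fun_cutoff b k (phi : 'rV[R]_m.+1 -> R) : test_fun setT phi ->
  test_fun (slab b) (fun x => cutoff b k x * phi x).
Proof.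
move=> [sphi [K [cK _ phiK]]]; split; first by apply: smoothM => //; exact: smooth_cutoff.
have k0 : 0 < k.+1%:R :> R by rewrite ltr0n.
exists (K `&` [set x | x 0 ord_max \in `[k.+1%:R^-1, b - k.+1%:R^-1]]); split.
- apply: compact_closedI => //.
  apply: (@preimage_closed 'rV[R]_m.+1 R (fun x => x 0 ord_max)
      `[k.+1%:R^-1, b - k.+1%:R^-1]); last exact: interval_closed.
  by move=> x _; exact: coord_continuous.
- move=> x [_] /=; rewrite in_itv/= => /andP[x1 x2]; apply/andP; split.
    by apply: lt_le_trans x1; rewrite invr_gt0.
  by apply: le_lt_trans x2 _; rewrite ltrBlDr ltrDl invr_gt0.
- move=> x /not_andP[/phiK ->|]; first by rewrite mulr0.
  rewrite /= in_itv/= => /negP; rewrite negb_and -!ltNge /cutoff => /orP[x1|x1].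
    rewrite flat_le0 ?mul0r// subr_le0.
    by rewrite mulrC -ler_pdivlMr// div1r ltW.
  rewrite [flat 0 (_ * (b - _) - 1)]flat_le0 ?mulr0 ?mul0r// subr_le0.
  by rewrite mulrC -ler_pdivlMr// div1r lerBlDl -lerBlDr ltW.
Qed.

Lemma cvg_int_cutoff b (f : 'rV[R]_m.+1 -> R) :
  lebesgue.-integrable (slab b) (EFin \o f) ->
  (fun k => \int[lebesgue]_(x in slab b) (cutoff b k x * f x)) @ \oo -->
  \int[lebesgue]_(x in slab b) f x.
Proof.
move=> iF; have mD := @measurable_slab R m b.
have mf : measurable_fun (slab b) f by apply/measurable_EFinP; exact: measurable_int iF.
have mc k : measurable_fun (slab b) (cutoff b k).
  apply: measurable_funTS; apply: continuous_measurable_rV.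
  exact/smooth_continuous/smooth_cutoff.
(* The cutoffs take values in [[0, 1]], so [|f|] dominates. *)
have [|//||||_ _ H] := @dominated_convergence _ _ _ lebesgue _ mD
   (fun k x => (cutoff b k x * f x)%:E) (EFin \o f) (fun x => `|f x|%:E).
- by move=> k; apply/measurable_EFinP; exact: measurable_funM.
- exact: measurable_int iF.
- apply: aeW => x Dx; apply: cvg_EFin; first exact: nearW.
  rewrite -[X in _ --> X]mul1r; apply: cvgM; first exact: cvg_cutoff.
  exact: cvg_cst.
- exact: integrable_norm iF.
- apply: aeW => x k Dx; rewrite lee_fin normrM ler_piMl//.
  by rewrite ger0_norm ?cutoff_ge0// cutoff_le1.
- by apply: fine_cvg; rewrite fineK//; exact: integrable_fin_num.
Qed.

End cutoff.

(** * Integration by parts in tangential directions *)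

Section tangential.
Context {R : realType} {m : nat}.
Variable b : R.
Notation D := (@slab R m b).
Implicit Types (F w G phi : 'rV[R]_m.+1 -> R).

(** The cutoff times [phi] is admissible in the definition of the weak derivative on the slab. The
    tangential derivative leaves the cutoff alone, so both sides converge as the cutoff tends to
    1. *)
Lemma tangential_test_fun j F w phi : j != ord_max -> is_wpderiv D j F w ->
  test_fun setT phi -> ip D F (pderiv j phi) = - ip D w phi.
Proof.
move=> jn [LF Lw Fw] tphi; have mD := @measurable_slab R m b.
have Lphi := test_fun_L2 mD tphi.
have Ldphi := test_fun_L2 mD (test_fun_pderiv j tphi).
have H k : \int[lebesgue]_(x in D) (cutoff b k x * (F x * pderiv j phi x)) =
    - \int[lebesgue]_(x in D) (cutoff b k x * (w x * phi x)).
  have := Fw _ (test_fun_cutoff b k tphi).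
  rewrite pderivM ?pderiv_cutoff//; [|exact: smooth_cutoff|by case: tphi].
  have -> : \int[lebesgue]_(x in D) (F x * (0 * phi x + cutoff b k x * pderiv j phi x))
      = \int[lebesgue]_(x in D) (cutoff b k x * (F x * pderiv j phi x)).
    by apply: eq_Rintegral => x _; rewrite mul0r add0r mulrCA.
  move=> ->; congr (- _).
  by apply: eq_Rintegral => x _; rewrite mulrCA.
have H1 := cvg_int_cutoff (L2_integrableM mD LF Ldphi).
have H2 := cvgN (cvg_int_cutoff (L2_integrableM mD Lw Lphi)).
move/funext in H; rewrite H in H1.
exact: (norm_cvg_unique H1 (H2 _)).
Qed.

(** Only [G] is approximated by smooth functions. For [F] a weak derivative in the single direction
    [j] is enough. *)
Lemma tangential_limit j F w G wG (phi : nat -> 'rV[R]_m.+1 -> R) :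
  j != ord_max -> is_wpderiv D j F w -> L2 D G -> L2 D wG ->
  (forall k, test_fun setT (phi k)) -> cvgL2 D phi G ->
  cvgL2 D (fun k => pderiv j (phi k)) wG -> ip D F wG = - ip D w G.
Proof.
move=> jn Fw LG LwG tphi phiG dphiG; have mD := @measurable_slab R m b.
have [LF Lw _] := Fw.
have cst_cvg f : L2 D f -> cvgL2 D (fun=> f) f.
  move=> _; rewrite /cvgL2 (_ : ip _ _ _ = 0); first exact: cvg_cst.
  by rewrite -[RHS](ip0l mD (fun=> 0)); apply: eq_Rintegral => x _; rewrite !subrr.
have H1 := cvg_ip mD (fun=> LF) LF
  (fun k => test_fun_L2 mD (test_fun_pderiv j (tphi k))) LwG (cst_cvg _ LF) dphiG.
have H2 := cvgN (cvg_ip mD (fun=> Lw) Lw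
  (fun k => test_fun_L2 mD (tphi k)) LG (cst_cvg _ Lw) phiG).
have /funext H : forall k, ip D F (pderiv j (phi k)) = - ip D w (phi k).
  by move=> k; exact: tangential_test_fun.
rewrite H in H1; exact: (norm_cvg_unique H1 (H2 _)).
Qed.

End tangential.

(** * Completeness of L^2 *)

Section L2_complete.
Context {R : realType} {n : nat}.
Variable D : set 'rV[R]_n.
Hypothesis mD : measurable D.
Variable a : nat -> 'rV[R]_n -> R.
Hypothesis La : forall k, L2 D (a k).
Let dist k l := ip D (fun x => a k x - a l x) (fun x => a k x - a l x).
Hypothesis cauchy_a : forall e, 0 < e -> exists N : nat,
  forall k l, (N <= k)%N -> (N <= l)%N -> dist k l <= e.

(** The rate [8^-1 ^+ j] for squared distances is chosen so that the weights [4 ^+ j] below leave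
    the summable [2^-1 ^+ j]. *)
Let fast_subseq : exists s : nat -> nat, {homo s : j k / (j <= k)%N} /\
  forall j k l, (s j <= k)%N -> (s j <= l)%N -> dist k l <= 8^-1 ^+ j.
Proof.
have /choice[N HN] : forall j : nat, exists N : nat,
    forall k l, (N <= k)%N -> (N <= l)%N -> dist k l <= 8^-1 ^+ j.
  by move=> j; apply: cauchy_a; rewrite exprn_gt0.
(* Partial sums of the thresholds dominate each threshold and are monotone. *)
exists (fun j => \sum_(i < j.+1) N i)%N; split.
  apply: homo_leq => // [i j k|j]; first exact: leq_trans.
  by rewrite [leqRHS]big_ord_recr/= leq_addr.
move=> j k l jk jl; apply: HN.
  by apply: leq_trans jk; rewrite big_ord_recr/= leq_addl.
by apply: leq_trans jl; rewrite big_ord_recr/= leq_addl.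
Qed.

Let s := sval (cid fast_subseq).
Let sP j k l : (s j <= k)%N -> (s j <= l)%N -> dist k l <= 8^-1 ^+ j.
Proof. by rewrite /s; case: cid => s' [_] /=; apply. Qed.
Let s_homo : {homo s : j k / (j <= k)%N}.
Proof. by rewrite /s; case: cid => s' []. Qed.

Let d j x := a (s j.+1) x - a (s j) x.

(* By Tonelli the weighted series is integrable, so almost everywhere its terms
   are bounded, i.e. [d j x] is O(2^-j). *)
Let wsum x := (\sum_(j <oo) (4 ^+ j * d j x ^+ 2)%:E)%E.

Let wterm_ge0 j x : 0 <= 4 ^+ j * d j x ^+ 2.
Proof. exact: mulr_ge0 (exprn_ge0 _ (ler0n _ _)) (sqr_ge0 _). Qed.

Let Ld j : L2 D (d j).
Proof. exact: L2B. Qed.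

Let int_wsum : (\int[lebesgue]_(x in D) wsum x < +oo)%E.
Proof.
rewrite integral_nneseries//; last 2 first.
- move=> j; apply/measurable_EFinP; apply: measurable_funM => //.
  by apply: measurable_funX; case: (Ld j).
- by move=> j x _; rewrite lee_fin wterm_ge0.
apply: (@le_lt_trans _ _ (\sum_(j <oo) (2^-1 ^+ j)%:E)%E).
  apply: lee_nneseries => [j _ _|j _].
    by apply: integral_ge0 => x _; rewrite lee_fin wterm_ge0.
  under eq_integral do rewrite EFinM.
  rewrite integralZl//; last exact: L2_integrable_sqr.
  rewrite (_ : (\int[lebesgue]_(x in D) _)%E = (dist (s j.+1) (s j))%:E); last first.
    by rewrite -L2norm2E//; exact: L2B.
  rewrite -EFinM lee_fin (_ : 2^-1 = 4 * 8^-1 :> R); last by lra.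
  by rewrite exprMn ler_wpM2l ?exprn_ge0// sP// s_homo.
have half1 : `|2^-1| < 1 :> R by rewrite ger0_norm// invf_lt1// ltr1n.
rewrite (_ : (\sum_(j <oo) _)%E = (limn (series (geometric 1 (2^-1 : R))))%:E) ?ltry//.
rewrite -EFin_lim; last exact: is_cvg_geometric_series.
congr (limn _); apply/funext => k; rewrite /= seriesEnat/= -sumEFin.
by apply: eq_bigr => i _; rewrite /= mul1r.
Qed.

(** Where [wsum x] is finite, the increments of the subsequence are dominated by a geometric series,
    so the telescoping series converges absolutely. *)
Let cvg_ae : {ae lebesgue, forall x, D x -> cvgn (fun j => a (s j) x)}.
Proof.
have mwsum : measurable_fun D wsum.
  apply: ge0_emeasurable_sum => [j x _ _|j _].
    by rewrite lee_fin wterm_ge0.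
  apply/measurable_EFinP; apply: measurable_funM => //.
  by apply: measurable_funX; case: (Ld j).
have wsum0 x : (0 <= wsum x)%E.
  by apply: nneseries_ge0 => j _ _; rewrite lee_fin wterm_ge0.
have iw : lebesgue.-integrable D wsum.
  apply/integrableP; split => //.
  by under eq_integral do rewrite gee0_abs//.
apply: filterS (integrable_ae mD iw) => x H Dx; have {H} := H Dx.
rewrite ge0_fin_numE// => wx.
pose M := fine (wsum x).
have M0 : 0 <= M by rewrite fine_ge0.
have dM j : `|d j x| <= Num.sqrt M * 2^-1 ^+ j.
  have : ((4 ^+ j * d j x ^+ 2)%:E <= M%:E)%E.
    rewrite fineK ?ge0_fin_numE//.
    have := @nneseries_lim_ge R (fun j => (4 ^+ j * d j x ^+ 2)%:E) xpredT 0%N j.+1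
      (fun i _ _ => wterm_ge0 i x).
    apply: le_trans; rewrite big_nat_recr//= leeDr// sume_ge0// => i _.
    by rewrite lee_fin wterm_ge0.
  rewrite lee_fin => H; rewrite -sqrtr_sqr.
  have -> : 2^-1 ^+ j = Num.sqrt ((2^-1 ^+ j) ^+ 2) :> R.
    by rewrite sqrtr_sqr ger0_norm// exprn_ge0.
  rewrite -sqrtrM//.
  apply: ler_wsqrtr; have -> : (2^-1 ^+ j) ^+ 2 = (4 ^+ j)^-1 :> R.
    by rewrite -exprM mulnC exprM -exprVn; congr (_ ^+ _); field.
  by rewrite ler_pdivlMr ?exprn_gt0// mulrC.
have cd : cvgn (series (telescope (fun j => a (s j) x))).
  apply: normed_cvg; apply: (@series_le_cvg _ _ (geometric (Num.sqrt M) 2^-1)).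
  - by move=> j; exact: normr_ge0.
  - by move=> j; rewrite /= mulr_ge0 ?sqrtr_ge0// exprn_ge0.
  - exact: dM.
  - by apply: is_cvg_geometric_series; rewrite ger0_norm// invf_lt1// ltr1n.
rewrite (_ : (fun j => _) =
    (fun j => a (s 0%N) x + series (telescope (fun j => a (s j) x)) j)).
  by apply: is_cvgD => //; exact: is_cvg_cst.
by apply/funext => j; exact: eq_sum_telescope.
Qed.

(** An upper limit is measurable without reference to the exceptional null set, and it equals the
    limit wherever that exists. *)
Let w x := fine (limn_esup (fun j => (a (s j) x)%:E)).

Let mw : measurable_fun D w.
Proof.
apply: measurableT_comp; first exact: fine_measurable.
apply: measurable_fun_limn_esup => j; apply/measurable_EFinP.
by case: (La (s j)).
Qed.

Let cvg_w : {ae lebesgue, forall x, D x -> (fun j => a (s j) x) @ \oo --> w x}.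
Proof.
apply: filterS cvg_ae => x H Dx; have /cvg_ex[l al] := H Dx.
have /cvg_limn_einf_sup[_ lE] : (fun j => (a (s j) x)%:E) @ \oo --> l%:E.
  by apply: cvg_EFin => //; exact: nearW.
by rewrite /w lE.
Qed.

(** Fatou's lemma along the subsequence turns the Cauchy estimate into an estimate for the distance
    to the limit. *)
Let fatou_w k N e : 0 <= e -> (forall l, (N <= l)%N -> dist (s l) k <= e) ->
  (\int[lebesgue]_(x in D) ((w x - a k x) ^+ 2)%:E <= e%:E)%E.
Proof.
move=> e0 He.
have mf j : measurable_fun D (fun x => ((a (s j) x - a k x) ^+ 2)%:E).
  apply/measurable_EFinP; apply: measurable_funX.
  by case: (L2B mD (La (s j)) (La k)).
have -> : (\int[lebesgue]_(x in D) ((w x - a k x) ^+ 2)%:E =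
   \int[lebesgue]_(x in D) limn_einf (fun j => ((a (s j) x - a k x) ^+ 2)%:E))%E.
  apply: ae_eq_integral => //.
  - apply/measurable_EFinP; apply: measurable_funX; apply: measurable_funB => //.
    by case: (La k).
  - rewrite (_ : (fun x => _) =
      (fun x => - limn_esup (fun j => - ((a (s j) x - a k x) ^+ 2)%:E))%E).
      apply: measurableT_comp => //; apply: measurable_fun_limn_esup => j.
      exact: measurableT_comp.
    apply/funext => x; rewrite -limn_einfN; congr limn_einf.
    by apply/funext => j; rewrite /= opprK.
  - apply: filterS cvg_w => x H Dx; have {}H := H Dx.
    have /cvg_limn_einf_sup[lE _] : (fun j => ((a (s j) x - a k x) ^+ 2)%:E) @ \oo
      --> ((w x - a k x) ^+ 2)%:E.
      apply: cvg_EFin; first exact: nearW.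
      rewrite expr2; under eq_fun do rewrite expr2.
      by apply: cvgM; (apply: cvgB => //; exact: cvg_cst).
    by rewrite lE.
apply: (le_trans (fatou _ mD mf _)).
  by move=> j x _; rewrite lee_fin sqr_ge0.
rewrite limn_einf_lim; apply: lime_le.
  exact: is_cvg_einfs.
(* The infimum over indices at least [j] is bounded by the term of index [maxn j N], to which the
   hypothesis applies. *)
apply: nearW => j; apply: (@le_trans _ _ (dist (s (maxn j N)) k)%:E).
  apply: ereal_inf_lbound; exists (maxn j N); first exact: leq_maxl.
  by rewrite -L2norm2E//; exact: L2B.
by rewrite lee_fin He// leq_maxr.
Qed.

Lemma L2_complete : exists2 w, L2 D w & cvgL2 D a w.
Proof.
have dist_s e : 0 < e -> exists N, forall k, (N <= k)%N ->
    (\int[lebesgue]_(x in D) ((w x - a k x) ^+ 2)%:E <= e%:E)%E.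
  move=> e0; have [j je] : exists j : nat, 8^-1 ^+ j <= e.
    have : (fun j => (8^-1 : R) ^+ j) @ \oo --> 0.
      by apply: cvg_expr; rewrite ger0_norm// invf_lt1// ltr1n.
    move/cvgr0_norm_le => /(_ e e0)[j _ /(_ j (leqnn j))].
    by rewrite /= ger0_norm ?exprn_ge0// => je; exists j.
  exists (s j) => k jk; apply: (@fatou_w _ j); first exact: ltW.
  by move=> l jl; apply: le_trans je; apply: sP => //; exact: s_homo.
have Lw : L2 D w.
  have [N HN] := dist_s 1 ltr01.
  (* Square-integrability of [w] comes from writing it as [(w - a N) + a N]. *)
  have LwN : L2 D (fun x => w x - a N x).
    split; last exact: le_lt_trans (HN N (leqnn N)) (ltry _).
    by apply: measurable_funB => //; case: (La N).
  have := L2D mD LwN (La N); congr L2; apply/funext => x; exact: subrK.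
exists w => //; rewrite /cvgL2; apply/cvgrPdist_le => e e0.
have [N HN] := dist_s e e0; exists N => // k /= Nk.
rewrite sub0r normrN ger0_norm ?ip_ge0// -lee_fin -L2norm2E//; last exact: L2B.
apply: le_trans (HN k Nk); rewrite le_eqVlt; apply/orP; left; apply/eqP.
by apply: eq_integral => x _; rewrite -sqrrN opprB.
Qed.

End L2_complete.

(** * Weak derivatives and traces *)

Lemma cvgn_sum {R : realType} (I : Type) (r : seq I) (F : I -> nat -> R) l :
  (forall i, F i @ \oo --> l i) ->
  (fun k => \sum_(i <- r) F i k) @ \oo --> \sum_(i <- r) l i.
Proof.
move=> Fl; elim: r => [|i r IH].
  by rewrite big_nil; under eq_fun do rewrite big_nil; exact: cvg_cst.
rewrite big_cons; under eq_fun do rewrite big_cons.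
by apply: cvgD.
Qed.

Lemma cvg_lincomb0 {R : realType} (a c : R) (u v : nat -> R) :
  u @ \oo --> 0 -> v @ \oo --> 0 -> (fun k => a * u k + c * v k) @ \oo --> 0.
Proof.
move=> u0 v0; have -> : 0 = a * 0 + c * 0 :> R by rewrite !mulr0 addr0.
by apply: cvgD; apply: cvgM => //; exact: cvg_cst.
Qed.

Section weak_derivatives.
Context {R : realType} {n : nat}.
Implicit Types (D : set 'rV[R]_n) (f w : 'rV[R]_n -> R).

Lemma sobolev_rec_L2 t k D f : sobolev_rec t k D f -> L2 D f.
Proof. by case: k => [[]|k []]. Qed.

Lemma sobolev_L2 r D f : sobolev r D f -> L2 D f.
Proof. exact: sobolev_rec_L2. Qed.

Lemma wpderivP D i f w : is_wpderiv D i f w -> is_wpderiv D i f (wpderiv D i f).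
Proof. by move=> h; apply: (@xgetPex _ (fun=> 0)); exists w. Qed.

Lemma sobolev_wpderiv r D i f : 1 <= r -> sobolev r D f ->
  is_wpderiv D i f (wpderiv D i f).
Proof.
rewrite /sobolev => r1; have : (0 < Num.truncn r)%N.
  by rewrite truncn_gt0.
by case: (Num.truncn r) => // k _ [_ /(_ i)[w /wpderivP]].
Qed.

Lemma wpderiv_L2 D i f : is_wpderiv D i f (wpderiv D i f) -> L2 D (wpderiv D i f).
Proof. by case. Qed.

(** A finite sum of nonnegative terms tends to 0 exactly when each term does. *)
Lemma H1dist2_cvgP D (phi : nat -> 'rV[R]_n -> R) f : measurable D ->
  (forall k, test_fun setT (phi k)) ->
  L2 D f -> (forall i, L2 D (wpderiv D i f)) ->
  ((fun k => H1dist2 D (phi k) f) @ \oo --> 0%E <->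
   cvgL2 D phi f /\
   forall i, cvgL2 D (fun k => pderiv i (phi k)) (wpderiv D i f)).
Proof.
move=> mD tphi Lf Ldf.
have L0 k := test_fun_L2 mD (tphi k).
have L1 i k := test_fun_L2 mD (test_fun_pderiv i (tphi k)).
have E k : H1dist2 D (phi k) f =
    (ip D (fun x => phi k x - f x) (fun x => phi k x - f x) +
     \sum_(i < n) ip D (fun x => pderiv i (phi k) x - wpderiv D i f x)
      (fun x => pderiv i (phi k) x - wpderiv D i f x))%:E.
  rewrite /H1dist2 L2norm2E//; last exact: L2B.
  rewrite EFinD; congr (_ + _)%E; rewrite -sumEFin; apply: eq_bigr => i _.
  by rewrite L2norm2E//; exact: L2B.
have -> : (fun k => H1dist2 D (phi k) f) @ \oo --> 0%E <->
  (fun k => ip D (fun x => phi k x - f x) (fun x => phi k x - f x) +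
     \sum_(i < n) ip D (fun x => pderiv i (phi k) x - wpderiv D i f x)
      (fun x => pderiv i (phi k) x - wpderiv D i f x)) @ \oo --> (0 : R).
  move/funext : E => ->; split => [/fine_cvgP[]//|h].
  by apply: cvg_EFin => //; exact: nearW.
split=> [H|[H0 H1]].
  split=> [|i].
    apply: squeeze_cvgr H; last exact: cvg_cst.
    by apply: nearW => k; rewrite ip_ge0/= lerDl sumr_ge0// => i _; exact: ip_ge0.
  apply: squeeze_cvgr H; last exact: cvg_cst.
  apply: nearW => k; rewrite ip_ge0/= (bigD1 i)//= addrCA lerDl addr_ge0 ?ip_ge0//.
  by rewrite sumr_ge0// => j _; exact: ip_ge0.
have S0 : \sum_(i < n) 0 = 0 :> R by rewrite big1.
rewrite -[X in _ --> X]addr0 -[X in _ --> _ + X]S0.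
by apply: cvgD => //; exact: cvgn_sum.
Qed.

End weak_derivatives.

(** * Traces on the two faces and integration by parts in the normal direction *)

Section trace.
Context {R : realType} {m : nat}.
Variable b : R.
Hypothesis b0 : 0 < b.
Notation D := (@slab R m b).
Notation dn := (pderiv (@ord_max m)).
Implicit Types (F G phi : 'rV[R]_m.+1 -> R) (w z : 'rV[R]_m -> R).
Let mD : measurable D. Proof. exact: measurable_slab. Qed.

Let at_height_L2 c phi : test_fun setT phi -> L2 setT (phi \o at_height c).
Proof.
move=> tphi; apply: continuous_bounded_support_L2 => //.
  move=> y; apply: (@continuous_comp _ _ _ (at_height c) phi).
    exact: continuous_at_height.
  exact: test_fun_continuous tphi _.
exact: bounded_support_at_height (test_fun_bounded_support tphi).
Qed.

Lemma ibp_test_fun phi psi : test_fun setT phi -> test_fun setT psi ->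
  ip D (dn phi) psi + ip D phi (dn psi) =
  ip setT (phi \o at_height b) (psi \o at_height b) -
  ip setT (phi \o at_height 0) (psi \o at_height 0).
Proof.
move=> tphi tpsi; have sM := smoothM tphi.1 tpsi.1.
have := @ftc_slab _ _ (fun x => phi x * psi x) b b0 (smooth_continuous sM)
  (fun x => smooth_derivable (i := ord_max) (x := x) sM)
  (smooth_continuous (smooth_pderiv ord_max sM))
  (bounded_supportMl _ (test_fun_bounded_support tphi)).
rewrite pderivM; [|exact: tphi.1|exact: tpsi.1].
have Lphi := test_fun_L2 mD tphi; have Lpsi := test_fun_L2 mD tpsi.
have Ldphi := test_fun_L2 mD (test_fun_pderiv ord_max tphi).
have Ldpsi := test_fun_L2 mD (test_fun_pderiv ord_max tpsi).
by move=> <-; rewrite /ip -RintegralD//; exact: L2_integrableM.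
Qed.

Lemma trace_ineq_top phi : test_fun setT phi ->
  b * ip setT (phi \o at_height b) (phi \o at_height b) <=
  (1 + b) * ip D phi phi + b * ip D (dn phi) (dn phi).
Proof.
move=> tphi; have [sphi _] := tphi.
(* The weight [x_n] kills the contribution of the bottom face and equals [b] on the top one. *)
pose theta x := (phi x * phi x) * x 0 ord_max.
have sM := smoothM sphi sphi.
have dx x : is_derive x (delta_mx 0 ord_max) (fun x : 'rV[R]_m.+1 => x 0 ord_max) (1 : R).
  have := is_derive_coord ord_max (is_derive_id (x 0 ord_max) (1 : R)).
  by rewrite eqxx mulr1.
have dtheta x : is_derive x (delta_mx 0 ord_max) theta
    (phi x * phi x + 2 * x 0 ord_max * phi x * dn phi x).
  have := is_deriveM (derivableP (smooth_derivable (i := ord_max) (x := x) sM)) (dx x).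
  move/is_derive_eq; apply.
  rewrite -![_ *: _]/(_ * _) mulr1; congr (_ + _).
  rewrite -[X in _ * X]/(dn (fun x => phi x * phi x) x) pderivM//; lra.
have ctheta : continuous theta.
  move=> x; apply: (@continuousM _ _ (fun x => phi x * phi x) (fun x => x 0 ord_max)).
    exact: smooth_continuous sM _.
  exact: coord_continuous.
have e : dn theta = (fun x => phi x * phi x + 2 * x 0 ord_max * phi x * dn phi x).
  by apply/funext => x; case: (dtheta x).
have cphi : continuous phi by exact: smooth_continuous.
have cdphi : continuous (dn phi) by apply: smooth_continuous; exact: smooth_pderiv.
have cdtheta : continuous (dn theta).
  rewrite e => x; apply: (@continuousD _ _ _ (fun x => phi x * phi x)).
    exact: smooth_continuous sM _.
  apply: (@continuousM _ _ (fun x : 'rV[R]_m.+1 => 2 * x 0 ord_max * phi x) (dn phi));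
    last exact: cdphi.
  apply: (@continuousM _ _ (fun x : 'rV[R]_m.+1 => 2 * x 0 ord_max) phi); last exact: cphi.
  apply: (@continuousM _ _ (fun=> 2) (fun x : 'rV[R]_m.+1 => x 0 ord_max)).
    exact: cst_continuous.
  exact: coord_continuous.
have btheta : bounded_support theta.
  by do 2 apply: bounded_supportMl; exact: test_fun_bounded_support tphi.
have H := @ftc_slab _ _ theta b b0 ctheta
  (fun x => @ex_derive _ _ _ _ _ _ _ (dtheta x)) cdtheta btheta.
have Lphi := test_fun_L2 mD tphi.
have Ldphi := test_fun_L2 mD (test_fun_pderiv ord_max tphi).
have -> : b * ip setT (phi \o at_height b) (phi \o at_height b) =
    \int[lebesgue]_(x in D) dn theta x.
  rewrite H (_ : \int[lebesgue]_y theta (at_height 0 y) = 0); last first.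
    under eq_Rintegral do rewrite /theta at_heightE mulr0.
    by rewrite Rintegral_cst// mul0r.
  rewrite subr0 /ip -RintegralZl//.
    by apply: eq_Rintegral => y _; rewrite /theta at_heightE mulrC.
  by apply: L2_integrableM => //; exact: at_height_L2.
rewrite /ip -!RintegralZl//; try exact: L2_integrableM.
have I1 : lebesgue.-integrable D (EFin \o (fun x => (1 + b) * (phi x * phi x))).
  exact: (integrableZl mD (1 + b) (L2_integrableM mD Lphi Lphi)).
have I2 : lebesgue.-integrable D (EFin \o (fun x => b * (dn phi x * dn phi x))).
  exact: (integrableZl mD b (L2_integrableM mD Ldphi Ldphi)).
rewrite -RintegralD//; apply: le_Rintegral => //.
- exact: continuous_bounded_support_integrable (bounded_support_pderiv _ btheta).
- exact: (integrableD mD I1 I2).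
move=> x /andP[x0 xb]; rewrite e.
set t := x 0 ord_max in x0 xb *; set p := phi x; set r := dn phi x.
(* These two inequalities give [2 t p r <= t (p^2 + r^2) <= b (p^2 + r^2)]. *)
have : 0 <= t * (p - r) ^+ 2 by rewrite mulr_ge0 ?sqr_ge0// ltW.
have : 0 <= (b - t) * (p ^+ 2 + r ^+ 2).
  by rewrite mulr_ge0 ?subr_ge0 ?(ltW xb)// addr_ge0 ?sqr_ge0.
nra.
Qed.

Lemma trace_ineq c : c = 0 \/ c = b -> exists2 C, 0 <= C &
  forall phi, test_fun setT phi ->
    ip setT (phi \o at_height c) (phi \o at_height c) <=
    C * (ip D phi phi + ip D (dn phi) (dn phi)).
Proof.
have Hb phi : test_fun setT phi ->
    ip setT (phi \o at_height b) (phi \o at_height b) <=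
    ((1 + b) / b) * (ip D phi phi + ip D (dn phi) (dn phi)).
  move=> tphi; rewrite mulrAC ler_pdivlMr// mulrC.
  apply: le_trans (trace_ineq_top tphi) _.
  by have := ip_ge0 D (dn phi); nra.
have C0 : 0 <= (1 + b) / b by rewrite divr_ge0 ?addr_ge0// ltW.
case=> ->; last by exists ((1 + b) / b).
(* By [ibp_test_fun] the boundary norms on the two faces differ by [2 * ip D (dn phi) phi], whose
   absolute value is at most the sum of the two interior terms. Hence the extra 1. *)
exists ((1 + b) / b + 1); first by rewrite addr_ge0.
move=> phi tphi; have := Hb _ tphi; have := ibp_test_fun tphi tphi.
have Lphi := test_fun_L2 mD tphi.
have Ldphi := test_fun_L2 mD (test_fun_pderiv ord_max tphi).
have := ip_ge0 D (fun x => phi x + dn phi x).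
by rewrite ip_sqrD// [ip D (dn phi) phi]ipC; lra.
Qed.

(** Of all the first derivatives only the normal one enters the trace inequality. *)
Let energy F dF phi := ip D (fun x => phi x - F x) (fun x => phi x - F x) +
  ip D (fun x => dn phi x - dF x) (fun x => dn phi x - dF x).

Let ip_sub_le f g h : L2 D f -> L2 D g -> L2 D h ->
  ip D (fun x => f x - g x) (fun x => f x - g x) <=
  2 * ip D (fun x => f x - h x) (fun x => f x - h x) +
  2 * ip D (fun x => g x - h x) (fun x => g x - h x).
Proof.
move=> Lf Lg Lh; have := ip_sqrD_le mD (L2B mD Lf Lh) (L2B mD Lh Lg).
have -> : ip D (fun x => h x - g x) (fun x => h x - g x) =
    ip D (fun x => g x - h x) (fun x => g x - h x).
  by apply: eq_Rintegral => x _; rewrite -!expr2 -sqrrN opprB.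
by under eq_fun do rewrite addrA subrK.
Qed.

(** The trace inequality is applied to the test function [phi - psi], and its interior norms are
    then compared through [F] and [dF], which need not be smooth. *)
Lemma trace_dist c : c = 0 \/ c = b -> exists2 C, 0 <= C &
  forall F dF phi psi, L2 D F -> L2 D dF -> test_fun setT phi -> test_fun setT psi ->
    ip setT (fun y => phi (at_height c y) - psi (at_height c y))
      (fun y => phi (at_height c y) - psi (at_height c y)) <=
    C * (energy F dF phi + energy F dF psi).
Proof.
move=> /trace_ineq[C C0 H]; exists (2 * C); first by rewrite mulr_ge0.
move=> F dF phi psi LF LdF tphi tpsi.
apply: (le_trans (H _ (test_funB tphi tpsi))).
rewrite pderivB; [|exact: tphi.1|exact: tpsi.1].
have Lphi := test_fun_L2 mD tphi; have Lpsi := test_fun_L2 mD tpsi.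
have Ldphi := test_fun_L2 mD (test_fun_pderiv ord_max tphi).
have Ldpsi := test_fun_L2 mD (test_fun_pderiv ord_max tpsi).
rewrite [2 * C]mulrC -mulrA ler_wpM2l// /energy.
move: (ip_sub_le Lphi Lpsi LF) (ip_sub_le Ldphi Ldpsi LdF).
move: (ip D (fun x => phi x - psi x) _) (ip D (fun x => phi x - F x) _)
  (ip D (fun x => psi x - F x) _) => A B A'.
move: (ip D (fun x => dn phi x - dn psi x) _) (ip D (fun x => dn phi x - dF x) _)
  (ip D (fun x => dn psi x - dF x) _) => A1 B1 C1; lra.
Qed.

Let cvg_energy (phi : nat -> 'rV[R]_m.+1 -> R) F dF : cvgL2 D phi F ->
  cvgL2 D (fun k => dn (phi k)) dF -> (fun k => energy F dF (phi k)) @ \oo --> 0.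
Proof. by move=> H1 H2; rewrite -(addr0 0); apply: cvgD. Qed.

Lemma trace_seq_exists c (phi : nat -> 'rV[R]_m.+1 -> R) F dF :
  c = 0 \/ c = b -> (forall k, test_fun setT (phi k)) -> L2 D F -> L2 D dF ->
  cvgL2 D phi F -> cvgL2 D (fun k => dn (phi k)) dF ->
  exists2 w, L2 setT w & cvgL2 setT (fun k => phi k \o at_height c) w.
Proof.
move=> /trace_dist[C C0 HC] tphi LF LdF cF cdF.
apply: L2_complete => // [k|e e0]; first exact: at_height_L2.
have C1 : 0 < C + 1 by rewrite ltr_wpDl.
(* The factor 2 accounts for the two energies, and [C + 1] avoids division by a constant [C] that
   may be zero. *)
have e'0 : 0 < e / (2 * (C + 1)) by rewrite divr_gt0// mulr_gt0.
have := cvg_energy cF cdF => /cvgr0_norm_le /(_ _ e'0)[N _ HN].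
exists N => k l Nk Nl; apply: le_trans (HC F dF _ _ LF LdF (tphi k) (tphi l)) _.
have Hk := le_trans (ler_norm _) (HN k Nk).
have Hl := le_trans (ler_norm _) (HN l Nl).
apply: (le_trans (ler_wpM2l C0 (lerD Hk Hl))).
have -> : C * (e / (2 * (C + 1)) + e / (2 * (C + 1))) = e * (C / (C + 1)).
  by field; rewrite gt_eqF.
by rewrite ler_piMr ?(ltW e0)// ler_pdivrMr// mul1r lerDl.
Qed.

(** By [trace_dist] the restrictions of two sequences with the same interior limits approach each
    other on the face. *)
Lemma trace_seq_unique c (phi psi : nat -> 'rV[R]_m.+1 -> R) F dF w :
  c = 0 \/ c = b -> (forall k, test_fun setT (phi k)) ->
  (forall k, test_fun setT (psi k)) -> L2 D F -> L2 D dF -> L2 setT w ->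
  cvgL2 D phi F -> cvgL2 D (fun k => dn (phi k)) dF ->
  cvgL2 D psi F -> cvgL2 D (fun k => dn (psi k)) dF ->
  cvgL2 setT (fun k => phi k \o at_height c) w ->
  cvgL2 setT (fun k => psi k \o at_height c) w.
Proof.
move=> /trace_dist[C C0 HC] tphi tpsi LF LdF Lw p1 p2 q1 q2 pw.
have H : (fun k => 2 * (C * energy F dF (psi k) + C * energy F dF (phi k)) +
    2 * ip setT (fun y => phi k (at_height c y) - w y)
      (fun y => phi k (at_height c y) - w y)) @ \oo --> (0 : R).
  apply: (cvg_lincomb0 2 2 _ pw).
  exact: (cvg_lincomb0 C C (cvg_energy q1 q2) (cvg_energy p1 p2)).
apply: squeeze_cvgr H; last exact: cvg_cst.
apply: nearW => k; rewrite ip_ge0/=.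
have Lp := at_height_L2 c (tphi k); have Lq := at_height_L2 c (tpsi k).
have := ip_sqrD_le measurableT (L2B measurableT Lq Lp) (L2B measurableT Lp Lw).
under eq_fun do rewrite addrA subrK.
move: (HC F dF _ _ LF LdF (tpsi k) (tphi k)); rewrite /comp.
move: (energy F dF (psi k)) (energy F dF (phi k)) => e1 e2.
move: (ip setT (fun y => psi k (at_height c y) - phi k (at_height c y)) _)
  (ip setT (fun y => phi k (at_height c y) - w y) _)
  (ip setT (fun y => psi k (at_height c y) - w y) _) => A B A'; lra.
Qed.

Lemma has_traceP c F w : has_trace b c F w -> [/\ L2 D F, L2 setT w,
  (forall i, is_wpderiv D i F (wpderiv D i F)) &
  exists phi : nat -> 'rV[R]_m.+1 -> R, [/\ forall k, test_fun setT (phi k),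
    cvgL2 D phi F, (forall i, cvgL2 D (fun k => pderiv i (phi k)) (wpderiv D i F)) &
    cvgL2 setT (fun k => phi k \o at_height c) w]].
Proof.
move=> [sF Lw [phi [tphi H1F trw]]].
have LF := sobolev_L2 sF.
have dF i : is_wpderiv D i F (wpderiv D i F) by exact: (sobolev_wpderiv i (lexx 1) sF).
split=> //; exists phi; move/(H1dist2_cvgP mD tphi LF (fun i => wpderiv_L2 (dF i))) : H1F.
move=> [H0 H1]; split=> //.
exact: (cvgL2P measurableT (fun k => at_height_L2 c (tphi k)) Lw).1 trw.
Qed.

(** The same approximating sequence serves both faces: its restrictions to the other face are
    Cauchy, and their limit is the trace there. *)
Lemma has_trace_other c c' F w : c = 0 \/ c = b -> c' = 0 \/ c' = b ->
  has_trace b c F w -> exists w', has_trace b c' F w'.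
Proof.
move=> hc hc' Fw; have [sF Lw [phi [tphi H1F _]]] := Fw.
have LF := sobolev_L2 sF.
have LdF i : L2 D (wpderiv D i F) by exact: (wpderiv_L2 (sobolev_wpderiv i (lexx 1) sF)).
have /(H1dist2_cvgP mD tphi LF LdF)[H0 H1] := H1F.
have [w' Lw' phiw'] := trace_seq_exists hc' tphi LF (LdF ord_max) H0 (H1 ord_max).
exists w'; split=> //; exists phi; split=> //.
exact: (cvgL2P measurableT (fun k => at_height_L2 c' (tphi k)) Lw').2 phiw'.
Qed.

Lemma ibp_normal F G w z : has_trace b b F w -> has_trace b b G z ->
  has_trace b 0 G (fun=> 0) ->
  ip D (wpderiv D ord_max F) G + ip D F (wpderiv D ord_max G) = ip setT w z.
Proof.
move=> Fw Gz G0.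
(* The bottom term vanishes in the limit because [G] has zero trace there, but this also requires
   the restrictions of the approximants of [F] to converge. *)
have [w0 Fw0] := has_trace_other (or_intror erefl) (or_introl erefl) Fw.
have [LF Lw dF [phi [tphi phiF dphiF phiw]]] := has_traceP Fw.
have [_ Lw0 _ [phi0 [tphi0 phi0F dphi0F phi0w]]] := has_traceP Fw0.
have [LG Lz dG [psi [tpsi psiG dpsiG psiz]]] := has_traceP Gz.
have [_ L0 _ [psi0 [tpsi0 psi0G dpsi0G psi00]]] := has_traceP G0.
have LdF := wpderiv_L2 (dF ord_max); have LdG := wpderiv_L2 (dG ord_max).
(* The traces on the two faces come with different sequences. Uniqueness allows one sequence for
   each function to be used on both faces. *)
have phiw0 := trace_seq_unique (or_introl erefl) tphi0 tphi LF LdF Lw0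
  phi0F (dphi0F _) phiF (dphiF _) phi0w.
have psi0' := trace_seq_unique (or_introl erefl) tpsi0 tpsi LG LdG L0
  psi0G (dpsi0G _) psiG (dpsiG _) psi00.
have Lphi k := test_fun_L2 mD (tphi k).
have Ldphi k := test_fun_L2 mD (test_fun_pderiv ord_max (tphi k)).
have Lpsi k := test_fun_L2 mD (tpsi k).
have Ldpsi k := test_fun_L2 mD (test_fun_pderiv ord_max (tpsi k)).
have lhs := cvgD (cvg_ip mD Ldphi LdF Lpsi LG (dphiF _) psiG)
  (cvg_ip mD Lphi LF Ldpsi LdG phiF (dpsiG _)).
have mT := @measurableT _ 'rV[R]_m.
have rhs := cvgB
  (cvg_ip mT (fun k => at_height_L2 b (tphi k)) Lw
    (fun k => at_height_L2 b (tpsi k)) Lz phiw psiz)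
  (cvg_ip mT (fun k => at_height_L2 0 (tphi k)) Lw0
    (fun k => at_height_L2 0 (tpsi k)) L0 phiw0 psi0').
rewrite ip0r// subr0 in rhs.
have /funext H : forall k, ip D (dn (phi k)) (psi k) + ip D (phi k) (dn (psi k)) =
  ip setT (phi k \o at_height b) (psi k \o at_height b) -
  ip setT (phi k \o at_height 0) (psi k \o at_height 0).
  by move=> k; exact: ibp_test_fun.
have {}rhs : (fun k => ip D (dn (phi k)) (psi k) + ip D (phi k) (dn (psi k))) @ \oo
    --> ip setT w z by rewrite H; exact: rhs.
exact: norm_cvg_unique (lhs _) rhs.
Qed.

End trace.

(** * Green's formula *)

Section weak_derivative_algebra.
Context {R : realType} {n : nat}.
Variable D : set 'rV[R]_n.
Hypothesis mD : measurable D.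
Implicit Types f g v w : 'rV[R]_n -> R.

Lemma is_wpderivD i f g v w : is_wpderiv D i f v -> is_wpderiv D i g w ->
  is_wpderiv D i (fun x => f x + g x) (fun x => v x + w x).
Proof.
move=> [Lf Lv fv] [Lg Lw gw]; split; [exact: L2D|exact: L2D|].
move=> phi tphi; have Lphi := test_fun_L2 mD tphi.
have Ldphi := test_fun_L2 mD (test_fun_pderiv i tphi).
have := ipDl mD Lf Lg Ldphi; have := ipDl mD Lv Lw Lphi.
by rewrite /ip => -> ->; rewrite fv// gw// opprD.
Qed.

Lemma is_wpderivN i f v : is_wpderiv D i f v ->
  is_wpderiv D i (fun x => - f x) (fun x => - v x).
Proof.
move=> [Lf Lv fv]; split; [exact: L2N|exact: L2N|].
move=> phi tphi; have Lphi := test_fun_L2 mD tphi.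
have Ldphi := test_fun_L2 mD (test_fun_pderiv i tphi).
have := ipNl mD Lf Ldphi; have := ipNl mD Lv Lphi.
by rewrite /ip => -> ->; rewrite fv.
Qed.

Lemma is_wpderiv_mulrb i f v (c : bool) : is_wpderiv D i f v ->
  is_wpderiv D i (fun x => f x *+ c) (fun x => v x *+ c).
Proof.
case: c => // _; split; [exact: L2_cst0|exact: L2_cst0|] => phi tphi.
by have := ip0l mD (pderiv i phi); have := ip0l mD phi; rewrite /ip => -> ->; rewrite oppr0.
Qed.

(* The two weak derivatives of [f] agree against test functions, in particular
   against the derivatives of test functions. *)
Lemma is_wpderiv_repr i j f v v' w : is_wpderiv D i f v -> is_wpderiv D i f v' ->
  is_wpderiv D j v w -> is_wpderiv D j v' w.
Proof.
move=> [_ _ fv] [_ Lv' fv'] [_ Lw vw]; split=> // phi tphi.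
rewrite -vw//; apply: oppr_inj; have tdphi := test_fun_pderiv j tphi.
by rewrite -fv// -fv'.
Qed.

(** The Sobolev hypothesis differentiates some representative of the first derivative, not
    necessarily the one chosen by [wpderiv]. [is_wpderiv_repr] transfers the second derivative. *)
Lemma sobolev_wpderiv2 r i j f : 2 <= r -> sobolev r D f ->
  is_wpderiv D j (wpderiv D i f) (wpderiv D j (wpderiv D i f)).
Proof.
move=> r2; rewrite /sobolev; have : (1 < Num.truncn r)%N.
  by rewrite truncn_ge_nat// (le_trans _ r2).
case: (Num.truncn r) => [//|[//|k]] _ [_ /(_ i)[v fv [_ /(_ j)[w vw _]]]].
exact: wpderivP (is_wpderiv_repr fv (wpderivP fv) vw).
Qed.

Lemma Rintegral_sumM (I : Type) (r : seq I) (F G : I -> 'rV[R]_n -> R) f g :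
  (forall i, L2 D (F i)) -> (forall i, L2 D (G i)) -> L2 D f -> L2 D g ->
  \int[lebesgue]_(x in D) ((\sum_(i <- r) F i x * G i x) - f x * g x) =
  \sum_(i <- r) ip D (F i) (G i) - ip D f g.
Proof.
move=> LF LG Lf Lg.
(* Integrability of the sum is carried through the induction because additivity of the real-valued
   integral needs it. *)
have [S1 S2] : lebesgue.-integrable D (EFin \o (fun x => \sum_(i <- r) F i x * G i x)) /\
    \int[lebesgue]_(x in D) (\sum_(i <- r) F i x * G i x) = \sum_(i <- r) ip D (F i) (G i).
  elim: r => [|i r [IH1 IH2]].
    split.
      have := L2_integrableM mD (L2_cst0 _) (L2_cst0 _).
      by apply: eq_integrable => // x _ /=; rewrite big_nil mulr0.
    rewrite big_nil -[RHS](ip0l mD (fun=> 0)); apply: eq_Rintegral => x _.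
    by rewrite big_nil mulr0.
  have Ii := L2_integrableM mD (LF i) (LG i).
  split.
    have := integrableD mD Ii IH1.
    by apply: eq_integrable => // x _ /=; rewrite big_cons EFinD.
  rewrite big_cons -IH2 -RintegralD//; apply: eq_Rintegral => x _.
  by rewrite big_cons.
by rewrite RintegralB// ?S2//; exact: L2_integrableM.
Qed.

End weak_derivative_algebra.

Section green.
Context {R : realType} {m : nat}.
Variable b : R.
Hypothesis b0 : 0 < b.
Notation D := (@slab R m b).
Implicit Types (F G p : 'rV[R]_m.+1 -> R) (i j : 'I_m.+1).
Implicit Types (u v : 'I_m.+1 -> 'rV[R]_m.+1 -> R).
Let mD : measurable D. Proof. exact: measurable_slab. Qed.

(** The trace of [G] enters only through the smooth approximating sequence it provides, so its
    height and value are arbitrary. *)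
Lemma ibp_tangential j F G c w : j != ord_max ->
  is_wpderiv D j F (wpderiv D j F) -> has_trace b c G w ->
  ip D (wpderiv D j F) G = - ip D F (wpderiv D j G).
Proof.
move=> jn dF /has_traceP[LG _ dG [phi [tphi phiG dphiG _]]].
by rewrite (tangential_limit jn dF LG (wpderiv_L2 (dG j)) tphi phiG (dphiG j)) opprK.
Qed.

Lemma is_wpderiv_stress r r' p u i j l : 1 <= r -> sobolev r D p ->
  2 <= r' -> (forall i, sobolev r' D (u i)) ->
  is_wpderiv D l (stress b p u i j) (wpderiv D l (stress b p u i j)).
Proof.
move=> r1 sp r2 su; have dp := sobolev_wpderiv l r1 sp.
have du i0 j0 := sobolev_wpderiv2 j0 l r2 (su i0).
apply: wpderivP; apply: is_wpderivD => //; first exact: is_wpderiv_mulrb dp.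
by apply: is_wpderivN => //; apply: is_wpderivD => //; exact: du.
Qed.

(** The factor paired with [wpderiv D j (v i)] is symmetric in [i] and [j], so this is half the
    integral of [Du : Dv]. *)
Definition strain_form u v : R := \sum_i \sum_j
  (ip D (wpderiv D j (u i)) (wpderiv D j (v i)) +
   ip D (wpderiv D i (u j)) (wpderiv D j (v i))).

Lemma strain_formC u v : strain_form u v = strain_form v u.
Proof.
pose S1 (w z : 'I_m.+1 -> 'rV[R]_m.+1 -> R) : R :=
  \sum_i \sum_j ip D (wpderiv D j (w i)) (wpderiv D j (z i)).
pose S2 (w z : 'I_m.+1 -> 'rV[R]_m.+1 -> R) : R :=
  \sum_i \sum_j ip D (wpderiv D i (w j)) (wpderiv D j (z i)).
have S12 w z : strain_form w z = S1 w z + S2 w z.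
  by rewrite -big_split; apply: eq_bigr => i _; rewrite -big_split.
have S1C w z : S1 w z = S1 z w.
  by apply: eq_bigr => i _; apply: eq_bigr => j _; exact: ipC.
(* Exchanging the roles of [i] and [j] swaps the two factors. *)
have S2C w z : S2 w z = S2 z w.
  rewrite [LHS]exchange_big.
  apply: eq_bigr => i _; apply: eq_bigr => j _. exact: ipC.
by rewrite [LHS]S12 [RHS]S12 S1C S2C.
Qed.

(** Row by row, the divergence is moved onto [v]; only the direction [x_n] leaves a boundary term,
    and only on the top face. Pairing the stress with the gradient of [v] then gives [p div v] minus
    the strain form. *)
Lemma green_stress r r' p u v (k z : 'I_m.+1 -> 'rV[R]_m -> R) :
  1 <= r -> sobolev r D p -> 2 <= r' -> (forall i, sobolev r' D (u i)) ->
  (forall i, has_trace b b (stress b p u i ord_max) (k i)) ->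
  (forall i, has_trace b 0 (v i) (fun=> 0)) ->
  (forall i, has_trace b b (v i) (z i)) ->
  \sum_i ip D (div_stress b p u i) (v i) =
  \sum_i ip setT (k i) (z i) - ip D p (wdiv b v) + strain_form u v.
Proof.
move=> r1 sp r2 su Tk v0 vz.
have dT i j l := is_wpderiv_stress i j l r1 sp r2 su.
have Lv i : L2 D (v i) by have [] := has_traceP (vz i).
have Ldv i j : L2 D (wpderiv D j (v i)).
  by have [_ _ /(_ j)/wpderiv_L2] := has_traceP (vz i).
have Lp := sobolev_L2 sp.
have Ldu i j : L2 D (wpderiv D j (u i)).
  by apply: (wpderiv_L2 (sobolev_wpderiv j _ (su i))); rewrite (le_trans _ r2)// ler1n.
have E1 i : ip D (div_stress b p u i) (v i) =
    ip setT (k i) (z i) - \sum_j ip D (stress b p u i j) (wpderiv D j (v i)).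
  rewrite ip_suml//; last by move=> j; exact: wpderiv_L2 (dT _ _ _).
  rewrite (bigD1 ord_max)//= [X in _ = _ - X](bigD1 ord_max)//=.
  have nE := ibp_normal b0 (Tk i) (vz i) (v0 i).
  have tE : \sum_(j < m.+1 | j != ord_max) ip D (wpderiv D j (stress b p u i j)) (v i) =
      - \sum_(j < m.+1 | j != ord_max) ip D (stress b p u i j) (wpderiv D j (v i)).
    rewrite -sumrN; apply: eq_bigr => j jn.
    exact: (ibp_tangential jn (dT _ _ _) (vz i)).
  by rewrite tE opprD addrA -nE addrK.
have E2 i j : ip D (stress b p u i j) (wpderiv D j (v i)) =
    ip D p (wpderiv D j (v i)) *+ (i == j) -
    (ip D (wpderiv D j (u i)) (wpderiv D j (v i)) +
     ip D (wpderiv D i (u j)) (wpderiv D j (v i))).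
  rewrite /stress /symgrad ipBl//; [|exact: L2_mulrb|exact: L2D].
  rewrite ipDl//; congr (_ - _).
  by case: (i == j) => //; exact: ip0l.
have -> : ip D p (wdiv b v) = \sum_i ip D p (wpderiv D i (v i)).
  by rewrite ipC ip_suml//; apply: eq_bigr => i _; exact: ipC.
rewrite (eq_bigr _ (fun i _ => E1 i)) sumrB -addrA; congr (_ + _).
rewrite (eq_bigr (fun i => ip D p (wpderiv D i (v i)) - \sum_j
  (ip D (wpderiv D j (u i)) (wpderiv D j (v i)) +
   ip D (wpderiv D i (u j)) (wpderiv D j (v i))))); last first.
  move=> i _; rewrite (eq_bigr _ (fun j _ => E2 i j)) sumrB; congr (_ - _).
  (* The pressure contributes only on the diagonal [j = i]. *)
  rewrite (bigD1 i)//= eqxx big1 ?addr0// => j /negbTE.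
  by rewrite eq_sym => ->.
by rewrite sumrB opprB addrC.
Qed.

End green.

Theorem theorem3p3 (R : realType) (m : nat) (hm : (2 <= m.+1)%N)
    (b gamma s : R) (hb : 0 < b) (hs : 0 <= s)
    (f : 'I_m.+1 -> 'rV[R]_m.+1 -> R) (g : 'rV[R]_m.+1 -> R)
    (h : 'rV[R]_m -> R) (k : 'I_m.+1 -> 'rV[R]_m -> R)
    (hf : forall i, sobolev s (slab b) (f i))
    (hg : sobolev (s + 1) (slab b) g)
    (hh : sobolev (s + 3 / 2) setT h)
    (hk : forall i, sobolev (s + 1 / 2) setT (k i))
    (hsol : exists u p, solves_overdetermined gamma s b f g h k u p)
    (psi : 'rV[R]_m -> R) (hpsi : sobolev (s + 1 / 2) setT psi)
    (v : 'I_m.+1 -> 'rV[R]_m.+1 -> R) (q : 'rV[R]_m.+1 -> R)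
    (hvq : solves_adjoint gamma s b psi v q) :
  (\int[lebesgue]_(x in slab b) ((\sum_i f i x * v i x) - g x * q x))
  - (\int[lebesgue]_y ((\sum_i k i y * trace b b (v i) y) - h y * psi y)) = 0.
Proof.
have [u [p [[su0 sp] eu gu Tk uh]]] := hsol.
have [[sv0 sq] ev gv Tpsi] := hvq.
have mD := @measurable_slab R m b.
have s1 : 1 <= s + 1 by rewrite lerDr.
have s2 : 2 <= s + 2 by rewrite lerDr.
have s12 : 1 <= s + 2 by rewrite (le_trans _ s2)// ler1n.
have su i : sobolev (s + 2) (slab b) (u i) by case: (su0 i).
have sv i : sobolev (s + 2) (slab b) (v i) by case: (sv0 i).
have u0 i : has_trace b 0 (u i) (fun=> 0) by case: (su0 i).
have v0 i : has_trace b 0 (v i) (fun=> 0) by case: (sv0 i).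
(* The zero trace at the bottom guarantees a trace on the top face, so [trace] does not return its
   default value. *)
have trP w : has_trace b 0 w (fun=> 0) -> has_trace b b w (trace b b w).
  move=> /(has_trace_other hb (or_introl erefl) (or_intror erefl))[z wz].
  by apply: (@xgetPex _ (fun=> 0)); exists z.
have vz i : has_trace b b (v i) (trace b b (v i)) by exact: trP.
(* The normal trace of [u] is taken to be the prescribed datum [h]. The tangential traces are not
   prescribed, and the adjoint load, being normal, does not see them. *)
pose zu i := if i == ord_max then h else trace b b (u i).
have uz i : has_trace b b (u i) (zu i).
  by rewrite /zu; case: eqP => [->//|_]; exact: trP.
have Lf i := sobolev_L2 (hf i); have Lg := sobolev_L2 hg.
have Lk i := sobolev_L2 (hk i); have Lh := sobolev_L2 hh.
have Lpsi := sobolev_L2 hpsi; have Lp := sobolev_L2 sp; have Lq := sobolev_L2 sq.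
have Lu i := sobolev_L2 (su i); have Lv i := sobolev_L2 (sv i).
have du i j := sobolev_wpderiv j s12 (su i); have dv i j := sobolev_wpderiv j s12 (sv i).
have Ldu i j := wpderiv_L2 (du i j); have Ldv i j := wpderiv_L2 (dv i j).
have Lz i : L2 setT (trace b b (v i)) by case: (vz i).
have LSu i : L2 (slab b) (div_stress b p u i).
  by apply: L2_sum => // j; exact: wpderiv_L2 (is_wpderiv_stress _ _ _ s1 sp s2 su).
have LSv i : L2 (slab b) (div_stress b q v i).
  by apply: L2_sum => // j; exact: wpderiv_L2 (is_wpderiv_stress _ _ _ s1 sq s2 sv).
have Gu := green_stress hb s1 sp s2 su Tk v0 vz.
have Gv := green_stress hb s1 sq s2 sv Tpsi u0 uz.
(* Here the dimension is at least 2: [x_1] is a tangential direction, so the term with [gamma]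
   integrates by parts without a boundary contribution. *)
have ord0n : (ord0 : 'I_m.+1) != ord_max by rewrite -(inj_eq val_inj) eq_sym -lt0n.
have divv : ip (slab b) p (wdiv b v) = 0.
  by rewrite ipC (ip_ae mD _ (L2_cst0 _) Lp gv) ?ip0l//; exact: L2_sum.
have divu : ip (slab b) q (wdiv b u) = ip (slab b) g q.
  by rewrite ipC (ip_ae mD _ Lg Lq gu)//; exact: L2_sum.
have fE i : ip (slab b) (f i) (v i) = ip (slab b) (div_stress b p u i) (v i) +
    gamma * ip (slab b) (wpderiv (slab b) ord0 (v i)) (u i).
  have Lgu := L2Z mD gamma (Ldu i ord0).
  rewrite -(ip_ae mD (L2B mD (LSu i) Lgu) (Lf i) (Lv i) (eu i)) ipBl// ipZl//.
  by rewrite (ibp_tangential ord0n (du _ _) (v0 i)) mulrN opprK (ipC _ (u i)).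
have adjE i : ip (slab b) (div_stress b q v i) (u i) =
    - (gamma * ip (slab b) (wpderiv (slab b) ord0 (v i)) (u i)).
  have Lgv := L2Z mD gamma (Ldv i ord0).
  have := ip_ae mD (L2D mD (LSv i) Lgv) (L2_cst0 _) (Lu i) (ev i).
  by rewrite ip0l// ipDl// ipZl// => /eqP; rewrite addr_eq0 => /eqP.
have psiE : \sum_i ip setT (fun y => psi y *+ (i == ord_max)) (zu i) = ip setT h psi.
  rewrite (bigD1 ord_max)//= big1 => [|i /negbTE in_]; last first.
    by rewrite in_; exact: ip0l.
  by rewrite addr0 /zu eqxx; exact: ipC.
(* [e] is the first-order term moved onto [v], [K] and [H] are the boundary pairings, [G] is the
   divergence pairing, and [E] is the common strain form. *)
pose e := \sum_i gamma * ip (slab b) (wpderiv (slab b) ord0 (v i)) (u i).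
pose K := \sum_i ip setT (k i) (trace b b (v i)).
pose E := strain_form b u v; pose G := ip (slab b) g q; pose H := ip setT h psi.
have fvE : \sum_i ip (slab b) (f i) (v i) = K + E + e.
  by rewrite (eq_bigr _ (fun i _ => fE i)) big_split /= Gu divv subr0.
(* Symmetry of the strain form puts the same [E] in both identities, so eliminating [e] cancels
   it. *)
have adj : - e = H - G + E.
  by move: Gv; rewrite (eq_bigr _ (fun i _ => adjE i)) sumrN psiE divu strain_formC.
transitivity (K + E + e - G - (K - H)); first by rewrite !Rintegral_sumM// fvE.
by clearbody e K E G H; rewrite -[e]opprK adj; ring.
Qed.
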